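(* Suppose that each gradient $\nabla f(\cdot,i)$, $i\in[n]$, is Lipschitz continuous on $\mathrm{dom}(\varphi)$ with modulus $\mathsf{L}>0$ and that $\varphi$ is $\rho$-weakly convex ($\rho>0$), lower semicontinuous and proper. Let $\psi^*:=\inf_{w\in\mathbb{R}^d}\psi(w)$, $\mathcal{W}:=\{w\in\mathbb{R}^d:\psi(w)=\psi^*\}$, and assume $\mathcal{W}\neq\emptyset$ and that $\psi$ satisfies the Polyak-{\L}ojasiewicz condition with constant $\mu>0$, i.e., $\mathrm{dist}(0,\partial\psi(w))^2\ge2\mu[\psi(w)-\psi^*]$ for all $w \in \mathrm{dom}(\varphi)$. Let $$\sigma_*^2:=\sup_{w\in\mathcal{W}}\Big[\frac1n\sum_{j=1}^n\|\nabla f(w,j)-\nabla f(w)\|^2\Big].$$ Let $\{w^k\}_k,\{z^k\}_k$ be generated by norm-PRR with $\lambda\in(0,\frac1{4\rho})$ and constant step sizes $$\alpha_k\equiv\frac{\alpha}{n},\qquad 0<\alpha\le\min\Big\{\bar\alpha,\ \nu^{-1},\ \frac{\mu\sqrt{\tau}}{2\mathsf{L}\sqrt{6\mathsf{C}}}\Big\},\qquad\nu:=\frac{\mu\tau}{3(1+\mu\tau\lambda)}.$$ (a) (For any sequence of permutations.) For all $T\ge1$, $$\psi(w^{T+1})-\psi^*\le\exp(-T\nu\alpha)\cdot\frac{H_\tau(z^1)-\psi^*}{1+\mu\tau\lambda}+\frac{6\mathsf{C}\alpha^2\sigma_*^2}{\mu\tau}.$$ (b) If, in addition, the permutations $\{\pi^k\}_k$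 are sampled independently (for each $k$) and uniformly at random from all permutations of $[n]$ (uniform sampling without replacement), then for all $T\ge1$, $$\mathbb{E}[\psi(w^{T+1})-\psi^*]\le\exp(-T\nu\alpha)\cdot\frac{H_\tau(z^1)-\psi^*}{1+\mu\tau\lambda}+\frac{6\mathsf{C}\alpha^2\sigma_*^2}{n\mu\tau}.$$
   Context: Setting: $d,n\in\mathbb{N}$, $[n]=\{1,\dots,n\}$; $f(\cdot,i):\mathbb{R}^d\to\mathbb{R}$ are differentiable; $f(w)=\frac1n\sum_{i=1}^n f(w,i)$; $\varphi:\mathbb{R}^d\to(-\infty,\infty]$; $\psi=f+\varphi$. $\|\cdot\|$ is the Euclidean norm. $\varphi$ is $\rho$-weakly convex if $\varphi+\frac{\rho}{2}\|\cdot\|^2$ is convex. $\partial$ denotes the Fr\'echet (regular) subdifferential, $\partial h(x)=\{g: h(y)\ge h(x)+\langle g,y-x\rangle+o(\|y-x\|)\text{ as }y\to x\}$; here $\partial\psi=\nabla f+\partial\varphi$. $\mathrm{dist}(0,\emptyset)=+\infty$. For $\lambda\in(0,\rho^{-1})$: $\mathrm{prox}_{\lambda\varphi}(w)=\mathrm{argmin}_y\,\varphi(y)+\frac1{2\lambda}\|w-y\|^2$, and the normal map is $F^\lambda_{\mathrm{nor}}(z)=\nabla f(\mathrm{prox}_{\lambda\varphi}(z))+\lambda^{-1}(z-\mathrm{prox}_{\lambda\varphi}(z))$. Algorithm norm-PRR: given a (deterministic) initial point $z^1\in\mathbb{R}^d$, $w^1=\mathrm{prox}_{\lambda\varphi}(z^1)$,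 step sizes $\alpha_k>0$ and $\lambda>0$; for $k=1,2,\dots$: choose a permutation $\pi^k=(\pi^k_1,\dots,\pi^k_n)$ of $[n]$; set $z^k_1=z^k$, $w^k_1=w^k$; for $i=1,\dots,n$ set $z^k_{i+1}=z^k_i-\alpha_k(\nabla f(w^k_i,\pi^k_i)+\frac1\lambda(z^k_i-w^k_i))$ and $w^k_{i+1}=\mathrm{prox}_{\lambda\varphi}(z^k_{i+1})$; set $z^{k+1}=z^k_{n+1}$, $w^{k+1}=w^k_{n+1}$. Constants: $\mathsf{C}=4\left[\frac{3\mathsf{L}+2\lambda^{-1}-\rho}{1-\lambda\rho}\right]^2$, $\tau=\frac{1-4\lambda\rho}{2(1-2\lambda\rho+\lambda^2\mathsf{L}^2)}$, $\bar\alpha=\max\{\sqrt{2\mathsf{C}},\,10\mathsf{L},\,4\mathsf{C}\lambda\tau^{-1}\}^{-1}$. Merit function: $H_\tau(z)=\psi(\mathrm{prox}_{\lambda\varphi}(z))+\frac{\tau\lambda}{2}\|F^\lambda_{\mathrm{nor}}(z)\|^2$. *)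

(* Defs.v *)
From HB Require Import structures.
From mathcomp Require Import all_boot all_order all_algebra all_fingroup finmap.
From mathcomp Require Import all_classical all_reals all_analysis.

Set Implicit Arguments.
Unset Strict Implicit.
Unset Printing Implicit Defensive.

Import Order.TTheory GRing.Theory Num.Theory.
Import numFieldNormedType.Exports.

Local Open Scope classical_set_scope.
Local Open Scope ring_scope.

Section Euclidean.
Context {R : realType} {d : nat}.
Local Notation V := 'rV[R]_d.

Definition edot (x y : V) : R := \sum_(j < d) x 0 j * y 0 j.

(* The norm [`|x|] that the library puts on ['rV[R]_d] is the sup norm. It
   induces the same topology and the same notion of differentiability, but the
   norm in the inequalities below has to be the Euclidean one. *)
Definition enorm (x : V) : R := Num.sqrt (\sum_(j < d) x 0 j ^+ 2).

(* The vector of partial derivatives; it represents ['d g x] with respect to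
   [edot] as soon as [g] is differentiable at [x]. *)
Definition grad (g : V -> R) (x : V) : V := \row_(j < d) 'D_(delta_mx 0 j) g x.

Definition dist_set (x : V) (S : set V) : \bar R :=
  ereal_inf [set (enorm (x - g))%:E | g in S].

End Euclidean.

Section ExtendedValued.
Context {R : realType} {d : nat}.
Local Notation V := 'rV[R]_d.
Local Open Scope ereal_scope.

Definition edom (h : V -> \bar R) : set V := [set x | h x < +oo].

Definition proper_efun (h : V -> \bar R) : Prop :=
  (forall x, h x != -oo) /\ edom h !=set0.

(* For functions that avoid [-oo]; recall that [0 * +oo = 0]. *)
Definition convex_efun (h : V -> \bar R) : Prop :=
  forall (x y : V) (t : R), (0 <= t <= 1)%R ->
    h (t *: x + (1 - t) *: y)%R <= t%:E * h x + (1 - t)%:E * h y.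

Definition weakly_convex (rho : R) (h : V -> \bar R) : Prop :=
  convex_efun (fun x => h x + (rho / 2 * enorm x ^+ 2)%:E).

(* Empty outside of the points where [h] is finite. The quantifier over [e]
   spells out the one-sided remainder [o(enorm (y - x))]. *)
Definition frechet_subdiff (h : V -> \bar R) (x : V) : set V :=
  [set g | h x \is a fin_num /\
     forall e : R, (0 < e)%R -> \forall y \near x,
       h x + (edot g (y - x) - e * enorm (y - x))%:E <= h y].

Definition argmin (h : V -> \bar R) : set V :=
  [set y | forall x, h y <= h x].

(* For [h] proper, lower semicontinuous and [rho]-weakly convex and for
   [lambda] in [(0, 1 / rho)] the minimizer exists and is unique; [0] is a junk
   value for the case of an empty [argmin]. *)
Definition prox (lambda : R) (h : V -> \bar R) (w : V) : V :=
  xget 0%R (argmin (fun y => h y + ((2 * lambda)^-1 * enorm (w - y) ^+ 2)%:E)).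

End ExtendedValued.

Section Problem.
Context {R : realType} {d n : nat}.
Local Notation V := 'rV[R]_d.
Variables (f : 'I_n -> V -> R) (phi : V -> \bar R).

Definition favg (w : V) : R := n%:R^-1 * \sum_(i < n) f i w.

Definition psi (w : V) : \bar R := ((favg w)%:E + phi w)%E.

Definition psi_inf : \bar R := ereal_inf (range psi).

Definition solutions : set V := [set w | psi w = psi_inf].

Definition lipschitz_gradients (L : R) : Prop :=
  forall (i : 'I_n) (x y : V), edom phi x -> edom phi y ->
    enorm (grad (f i) x - grad (f i) y) <= L * enorm (x - y).

Definition PL_condition (mu : R) : Prop :=
  forall w, edom phi w ->
    ((2 * mu)%:E * (psi w - psi_inf)
       <= dist_set 0%R (frechet_subdiff psi w) ^+ 2)%E.

(* Possibly [+oo], as [solutions] may be unbounded. *)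
Definition sigma_star_sq : \bar R :=
  ereal_sup [set (n%:R^-1 *
      \sum_(j < n) enorm (grad (f j) w - grad favg w) ^+ 2)%:E
    | w in solutions].

Definition normal_map (lambda : R) (z : V) : V :=
  grad favg (prox lambda phi z) + lambda^-1 *: (z - prox lambda phi z).

Definition merit (lambda tau : R) (z : V) : \bar R :=
  (psi (prox lambda phi z)
     + (tau * lambda / 2 * enorm (normal_map lambda z) ^+ 2)%:E)%E.

Section Algorithm.
Variable lambda : R.

(* States are pairs [(z, w)]. *)
Definition inner_step (a : R) (s : 'S_n) (zw : V * V) (i : 'I_n) : V * V :=
  let z' := zw.1 - a *: (grad (f (s i)) zw.2 + lambda^-1 *: (zw.1 - zw.2)) in
  (z', prox lambda phi z').

Definition epoch (a : R) (s : 'S_n) (zw : V * V) : V * V :=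
  foldl (inner_step a s) zw (enum 'I_n).

(* Zero-based: [norm_PRR alpha p z1 k] is the pair (z^{k+1}, w^{k+1}), and
   [alpha k], [p k] are the step size and the permutation used to compute
   (z^{k+2}, w^{k+2}) from it. *)
Fixpoint norm_PRR (alpha : nat -> R) (p : nat -> 'S_n) (z1 : V) (k : nat)
    : V * V :=
  if k is k'.+1 then epoch (alpha k') (p k') (norm_PRR alpha p z1 k')
  else (z1, prox lambda phi z1).

End Algorithm.
End Problem.

Section Constants.
Context {R : realType}.
Variables (L rho lambda mu : R).

Definition PRR_C : R :=
  4 * ((3 * L + 2 * lambda^-1 - rho) / (1 - lambda * rho)) ^+ 2.

Definition PRR_tau : R :=
  (1 - 4 * lambda * rho) /
  (2 * (1 - 2 * lambda * rho + lambda ^+ 2 * L ^+ 2)).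

Definition PRR_alpha_bar : R :=
  (Num.max (Num.sqrt (2 * PRR_C))
     (Num.max (10 * L) (4 * PRR_C * lambda * PRR_tau^-1)))^-1.

Definition PRR_nu : R := mu * PRR_tau / (3 * (1 + mu * PRR_tau * lambda)).

End Constants.

Section RandomPermutations.
Context {R : realType} {disp : measure_display} {Omega : measurableType disp}.
Variables (P : probability Omega R) (n : nat) (p : nat -> Omega -> 'S_n).

Definition mutually_independent : Prop :=
  forall (J : {fset nat}) (A : nat -> set 'S_n),
    fine (P (\bigcap_(k in [set` J]) (p k @^-1` A k))) =
    \prod_(k <- J) fine (P (p k @^-1` A k)).

Definition uniform_permutations : Prop :=
  forall (k : nat) (s : 'S_n), P (p k @^-1` [set s]) = (n`!%:R^-1)%:E.

(* [measurable] is with respect to the discrete sigma-algebra on ['S_n]. *)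
Definition independent_uniform_permutations : Prop :=
  [/\ forall (k : nat) (A : set 'S_n), measurable (p k @^-1` A),
      uniform_permutations & mutually_independent].

End RandomPermutations.

(* Main.v *)
(* The vector F(z) = normal_map z is a Frechet subgradient of psi at prox z, so
   the PL condition bounds psi (prox z) - psi* by a multiple of |F(z)|^2. One epoch
   is an inexact step z' = z - alpha F(z) + e. Since prox is monotone and Lipschitz,
   such a step decreases the merit function by a multiple of alpha |F(z)|^2, up to a
   multiple of |e|^2 / alpha. The error e is governed by |F(z)|^2 and by the partial
   sums of the centred component gradients at prox z in the order of the permutation.
   Their squares are bounded by the gradient variance at prox z: by Cauchy-Schwarz
   for every permutation, and with an additional factor 1 / n on average, because
   sampling without replacement is negatively correlated. The PL condition also
   implies quadratic growth, hence the variance is at most 2 sigma*^2 plus a multiple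
   of psi - psi*, which the decrease absorbs. The outcome is an affine contraction of
   the merit gap that can be iterated; in the random case the expectation over T
   epochs is the average over all T-tuples of permutations. *)

Require Import Defs.
From HB Require Import structures.
From mathcomp Require Import all_boot all_order all_algebra all_fingroup finmap.
From mathcomp Require Import all_classical all_reals all_analysis.
From mathcomp Require Import measurable_realfun ring lra.

Set Implicit Arguments.
Unset Strict Implicit.
Unset Printing Implicit Defensive.

Import Order.TTheory GRing.Theory Num.Theory.
Import numFieldNormedType.Exports.

Local Open Scope classical_set_scope.
Local Open Scope ring_scope.

(** * Euclidean geometry *)

(** The merit function is needed because [psi] at [prox z] alone need not decrease by a multiple of
    |F(z)|^2: while z moves, [prox z] can stay where it is. The term with |F|^2 supplies the
    decrease there. It also uses up part of the negative multiple of |D|^2 that monotonicity of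
    [prox] provides, D being the change of [prox z], and the weight tau keeps that part small
    enough. A second obstacle is that sigma* controls the component gradients at minimizers of [psi]
    only. Each iterate therefore has to be compared with a minimizer close to it, and the price is a
    multiple of alpha^3 times the gap of [psi]. The bound on alpha that involves mu makes this price
    a fixed fraction of the decrease. No conditional expectations occur in the random case. The
    bound after T epochs is affine in the initial merit value, so the first permutation can be
    averaged out for each fixed starting point and the remaining epochs are handled by induction. *)

Section EuclideanSpace.
Context {R : realType} {d : nat}.
Implicit Types (x y z : 'rV[R]_d) (a : R).

Lemma edotC x y : edot x y = edot y x.
Proof. by apply: eq_bigr => j _; rewrite mulrC. Qed.

Lemma edotDl x y z : edot (x + y) z = edot x z + edot y z.
Proof. by rewrite -big_split; apply: eq_bigr => j _; rewrite mxE mulrDl. Qed.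

Lemma edotZl a x y : edot (a *: x) y = a * edot x y.
Proof. by rewrite mulr_sumr; apply: eq_bigr => j _; rewrite mxE mulrA. Qed.

Lemma edotDr x y z : edot x (y + z) = edot x y + edot x z.
Proof. by rewrite !(edotC x) edotDl. Qed.

Lemma edotZr a x y : edot x (a *: y) = a * edot x y.
Proof. by rewrite !(edotC x) edotZl. Qed.

Lemma edotNl x y : edot (- x) y = - edot x y.
Proof. by rewrite -scaleN1r edotZl mulN1r. Qed.

Lemma edotNr x y : edot x (- y) = - edot x y.
Proof. by rewrite -scaleN1r edotZr mulN1r. Qed.

Lemma edot0l x : edot 0 x = 0.
Proof. by rewrite -(scale0r 0) edotZl mul0r. Qed.

Lemma edot_suml (I : Type) (r : seq I) (P : pred I) (v : I -> 'rV[R]_d) y :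
  edot (\sum_(i <- r | P i) v i) y = \sum_(i <- r | P i) edot (v i) y.
Proof.
exact: (big_morph (edot^~ y) (fun x z => edotDl x z y) (edot0l y)).
Qed.

Lemma edot_sumr (I : Type) (r : seq I) (P : pred I) (v : I -> 'rV[R]_d) y :
  edot y (\sum_(i <- r | P i) v i) = \sum_(i <- r | P i) edot y (v i).
Proof. by rewrite edotC edot_suml; apply: eq_bigr => i _; rewrite edotC. Qed.

Definition edotE :=
  (edotDl, edotDr, edotNl, edotNr, edotZl, edotZr).

Lemma enorm_ge0 x : 0 <= enorm x.
Proof. exact: sqrtr_ge0. Qed.

Lemma enorm_sqr x : enorm x ^+ 2 = edot x x.
Proof.
by rewrite sqr_sqrtr ?sumr_ge0// => j _; rewrite sqr_ge0.
Qed.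

Lemma edot_ge0 x : 0 <= edot x x.
Proof. by rewrite -enorm_sqr sqr_ge0. Qed.

Lemma enorm_eq0 x : enorm x = 0 -> x = 0.
Proof.
move=> x0; have := enorm_sqr x; rewrite x0 expr0n/= => /esym/eqP.
rewrite psumr_eq0 => [/allP xj0|j _]; last by rewrite -expr2 sqr_ge0.
apply/rowP => j; rewrite mxE; have := xj0 j (mem_index_enum j).
by rewrite mulf_eq0 orbb => /eqP.
Qed.

Lemma enormD_sqr x y :
  enorm (x + y) ^+ 2 = enorm x ^+ 2 + 2 * edot x y + enorm y ^+ 2.
Proof. by rewrite !enorm_sqr !edotE (edotC y x); ring. Qed.

Lemma enormB_sqr x y :
  enorm (x - y) ^+ 2 = enorm x ^+ 2 - 2 * edot x y + enorm y ^+ 2.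
Proof. by rewrite enormD_sqr edotNr !enorm_sqr !edotE; ring. Qed.

Lemma edot_young a x y : 0 < a -> 2 * edot x y <= a * edot x x + a^-1 * edot y y.
Proof.
move=> a0; have := edot_ge0 (a *: x - y); rewrite !edotE (edotC y x) => h.
rewrite -(ler_pM2l a0) mulrDr mulVKf ?gt_eqF//; lra.
Qed.

Lemma edot_le x y : edot x y <= enorm x * enorm y.
Proof.
have [y0|y0] := eqVneq (enorm y) 0.
  by rewrite (enorm_eq0 y0) edotC edot0l mulr_ge0 ?enorm_ge0.
have [x0|x0] := eqVneq (enorm x) 0.
  by rewrite (enorm_eq0 x0) edot0l mulr_ge0 ?enorm_ge0.
have xp : 0 < enorm x by rewrite lt_def x0 enorm_ge0.
have yp : 0 < enorm y by rewrite lt_def y0 enorm_ge0.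
have := edot_young x y (divr_gt0 yp xp); rewrite invf_div -!enorm_sqr.
have -> : enorm y / enorm x * enorm x ^+ 2 = enorm x * enorm y by field.
have -> : enorm x / enorm y * enorm y ^+ 2 = enorm x * enorm y by field.
lra.
Qed.

Lemma enormN x : enorm (- x) = enorm x.
Proof. by congr Num.sqrt; apply: eq_bigr => j _; rewrite mxE sqrrN. Qed.

Lemma enormB x y : enorm (x - y) = enorm (y - x).
Proof. by rewrite -enormN opprB. Qed.

Lemma enormZ a x : enorm (a *: x) = `|a| * enorm x.
Proof.
apply/eqP; rewrite -(eqrXn2 (n := 2))// ?mulr_ge0 ?enorm_ge0//.
by rewrite exprMn !enorm_sqr !edotE -normrX ger0_norm ?sqr_ge0// mulrA.
Qed.

Lemma enormZ_sqr a x : enorm (a *: x) ^+ 2 = a ^+ 2 * enorm x ^+ 2.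
Proof. by rewrite enormZ exprMn real_normK ?num_real. Qed.

Lemma ler_enormD x y : enorm (x + y) <= enorm x + enorm y.
Proof.
rewrite -(ler_pXn2r (n := 2)) ?nnegrE ?addr_ge0 ?enorm_ge0//.
rewrite sqrrD !enorm_sqr !edotE (edotC y x).
have := edot_le x y; lra.
Qed.

Lemma enorm_le_sqr x y a :
  0 <= a -> edot x x <= a ^+ 2 * edot y y -> enorm x <= a * enorm y.
Proof.
move=> a0 h; rewrite -(ler_pXn2r (n := 2)) ?nnegrE ?mulr_ge0 ?enorm_ge0//.
by rewrite exprMn !enorm_sqr.
Qed.

Lemma sqr_enorm_le x y a :
  enorm x <= a * enorm y -> edot x x <= a ^+ 2 * edot y y.
Proof.
move=> h; rewrite -!enorm_sqr -exprMn lerXn2r// nnegrE ?enorm_ge0//.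
exact: le_trans (enorm_ge0 x) h.
Qed.

Lemma edot_sum_le (I : finType) (A : {pred I}) (v : I -> 'rV[R]_d) :
  edot (\sum_(i in A) v i) (\sum_(i in A) v i)
    <= #|A|%:R * \sum_(i in A) edot (v i) (v i).
Proof.
have H i j : edot (v i) (v j) <= 2^-1 * edot (v i) (v i) + 2^-1 * edot (v j) (v j).
  have := edot_young (v i) (v j) (@ltr01 R); lra.
rewrite edot_suml.
apply: (@le_trans _ _ (\sum_(i in A) \sum_(j in A)
   (2^-1 * edot (v i) (v i) + 2^-1 * edot (v j) (v j)))).
  by apply: ler_sum => i _; rewrite edot_sumr ler_sum.
set S := \sum_(i in A) edot (v i) (v i).
have -> : #|A|%:R * S = \sum_(i in A) 2^-1 * (#|A|%:R * edot (v i) (v i)) +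
    #|A|%:R * (2^-1 * S).
  by rewrite -mulr_sumr -mulr_sumr -/S; lra.
rewrite le_eqVlt; apply/orP; left; apply/eqP.
have -> : #|A|%:R * (2^-1 * S) = \sum_(i in A) 2^-1 * S.
  by rewrite sumr_const mulr_natl.
rewrite -big_split; apply: eq_bigr => i _.
by rewrite big_split sumr_const -mulr_sumr; congr (_ + _); rewrite -mulr_natl; ring.
Qed.

Lemma edot_mean_le n (v : 'I_n -> 'rV[R]_d) :
  edot (n%:R^-1 *: \sum_(i < n) v i) (n%:R^-1 *: \sum_(i < n) v i)
    <= n%:R^-1 * \sum_(i < n) edot (v i) (v i).
Proof.
case: n v => [v|n v]; first by rewrite !big_ord0 scaler0 edot0l mulr0.
rewrite !edotE ler_pM2l ?invr_gt0 ?ltr0n// ler_pdivrMl ?ltr0n//.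
by have := edot_sum_le predT v; rewrite card_ord.
Qed.

Lemma edot_add3_le x y z :
  edot (x + y + z) (x + y + z) <= 3 * (edot x x + edot y y + edot z z).
Proof.
have xy := edot_young x y (@ltr01 R); have xz := edot_young x z (@ltr01 R).
have yz := edot_young y z (@ltr01 R).
rewrite invr1 !mul1r in xy xz yz.
rewrite !edotE (edotC y x) (edotC z x) (edotC z y); lra.
Qed.

Lemma enorm_le_norm x : enorm x <= d%:R * `|x|.
Proof.
have h : edot x x <= d%:R * `|x| ^+ 2.
  rewrite mulr_natl -[X in _ *+ X]card_ord -sumr_const; apply: ler_sum => j _.
  rewrite -expr2 -[leLHS]real_normK ?num_real// lerXn2r ?nnegrE//.
  have /mapP[k Hk ->] : `|x 0 j| \in [seq `|x v.1 v.2| | v : 'I_1 * 'I_d].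
    by apply/mapP; exists (0, j) => //=; rewrite mem_enum.
  by rewrite [leRHS]/Num.norm /= mx_normrE; apply/bigmax_geP; right => /=; exists k.
rewrite -(ler_pXn2r (n := 2)) ?nnegrE ?mulr_ge0 ?enorm_ge0//.
rewrite exprMn enorm_sqr; apply: le_trans h _; apply: ler_wpM2r.
  by rewrite sqr_ge0.
by rewrite -natrX ler_nat; case: (d) => // k; rewrite leq_pmulr.
Qed.

Lemma norm_le_enorm x : `|x| <= enorm x.
Proof.
rewrite [leLHS]/Num.norm /= mx_normrE; apply/bigmax_leP; split => [|[i j] _ /=].
  exact: enorm_ge0.
rewrite (ord1 i) -(ler_pXn2r (n := 2)) ?nnegrE ?enorm_ge0// enorm_sqr.
rewrite real_normK ?num_real// /edot (bigD1 j)//= -expr2 lerDl.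
by apply: sumr_ge0 => k _; rewrite -expr2 sqr_ge0.
Qed.

Lemma nbhs_enorm x (e : R) : 0 < e -> \forall y \near x, enorm (y - x) < e.
Proof.
move=> e0; have d0 : 0 < e / d.+1%:R by rewrite divr_gt0.
apply: (@filterS _ (nbhs x)) (nbhsx_ballx x _ d0) => y; rewrite -ball_normE /= distrC => xy.
apply: le_lt_trans (enorm_le_norm _) _.
rewrite ltr_pdivlMr// in xy; apply: le_lt_trans xy.
by rewrite mulrC ler_wpM2l// ler_nat.
Qed.

Lemma enormB_continuous (c : 'rV[R]_d) : continuous (fun y => enorm (y - c)).
Proof.
move=> x; apply/(@cvgrPdist_lt _ R^o _ _ (nbhs_filter x)) => e e0.
apply: (@filterS _ (nbhs x)) (nbhs_enorm x e0) => y xy.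
apply: le_lt_trans xy; rewrite ler_norml.
have := ler_enormD (y - x) (x - c); have := ler_enormD (x - y) (y - c).
rewrite !addrA !subrK (enormB x y); lra.
Qed.

Lemma compact_eball x (M : R) : compact [set y | enorm (y - x) <= M].
Proof.
apply: bounded_closed_compact.
  exists (M + enorm x); split; first exact: num_real.
  move=> N MN y /= yM; apply: le_trans (norm_le_enorm _) _.
  by have := ler_enormD (y - x) x; rewrite subrK; lra.
apply: (@preimage_closed _ R^o (fun y => enorm (y - x)) [set r | r <= M]).
  by move=> y _; exact: enormB_continuous.
exact: closed_le.
Qed.

End EuclideanSpace.

(** * Lower semicontinuous functions and proximal maps *)

Section LowerSemicontinuity.
Context {R : realType}.
Local Open Scope ereal_scope.

(** The order on values is total, so the sublevel sets at levels [h y], [y] in [K], form a filter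
    base. A cluster point [x] is a minimizer: if [h y < h x], then [h] stays above a real level near
    [x], away from the sublevel set of [y]. *)
Lemma lsc_compact_min (T : topologicalType) (K : set T) (h : T -> \bar R) :
  compact K -> K !=set0 -> lower_semicontinuous h ->
  exists2 x, K x & forall y, K y -> h x <= h y.
Proof.
move=> cK [x0 Kx0] lsch.
pose F := filter_from K (fun y => K `&` [set x | h x <= h y]).
have FF : ProperFilter F.
  apply: filter_from_proper; last by move=> y Ky; exists y; split => /=.
  apply: filter_from_filter; first by exists x0.
  move=> y z Ky Kz; have [yz|/ltW zy] := leP (h y) (h z).
    by exists y => // u [Ku uy]; split; split => //; exact: le_trans yz.
  by exists z => // u [Ku uz]; split; split => //; exact: le_trans zy.
have FK : F K by exists x0 => // u [].
have [x [Kx clx]] := cK F FF FK; exists x => // y Ky.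
rewrite leNgt; apply/negP => yx.
have [a ax ya] : exists2 a : R, a%:E < h x & forall u, h u <= h y -> ~~ (a%:E < h u).
  case Ey : (h y) yx => [r| |] yx //.
  - by exists r => // u; rewrite -leNgt.
  - by rewrite ltNge leey in yx.
  case Ex : (h x) yx => [s| |] yx //.
  - by exists (s - 1)%R => [|u]; [rewrite lte_fin; lra|rewrite leeNy_eq => /eqP ->].
  - by exists 0%R => [|u]; [rewrite ltry|rewrite leeNy_eq => /eqP ->].
have [V Vx Va] := lsch x a ax.
have [u [[Ku uy] Vu]] : (K `&` [set u | h u <= h y]) `&` V !=set0.
  by apply: clx => //; exists y.
by have := ya u uy; rewrite Va.
Qed.

Lemma lsc_addr (T : topologicalType) (h : T -> \bar R) (c : T -> R) :
  lower_semicontinuous h -> continuous c ->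
  lower_semicontinuous (fun x => h x + (c x)%:E).
Proof.
move=> lsch cc x a axc.
have [b [e [e0 bx abe]]] : exists b e, [/\ (0 < e)%R, b%:E < h x & (a <= b + c x - e)%R].
  case Ex : (h x) axc => [r| |] //= axc.
    exists ((r - c x + a) / 2)%R, ((r + c x - a) / 2)%R.
    rewrite -EFinD !lte_fin in axc *; split; lra.
  by exists (a - c x + 1)%R, 1%R; rewrite ltry; split => //; lra.
have [V Vx Vb] := lsch x b bx.
have [W Wx Wc] : exists2 W, nbhs x W & forall y, W y -> (c x - e < c y)%R.
  exists [set y | (`|c x - c y| < e)%R].
    by have /cvgrPdist_lt/(_ e e0) := cc x.
  by move=> y /=; rewrite ltr_norml; lra.
exists (V `&` W); first exact: filterI.
move=> y [/Vb by_ /Wc cy]; apply: (@le_lt_trans _ _ (b + c y)%:E).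
  by rewrite lee_fin; lra.
by rewrite EFinD lteD2rE.
Qed.

Lemma lsc_argmin d (h : 'rV[R]_d -> \bar R) (x0 c : 'rV[R]_d) (M : R) :
  lower_semicontinuous h -> (forall y, h y <= h x0 -> (enorm (y - c) <= M)%R) ->
  argmin h !=set0.
Proof.
move=> lsch coer.
have [|x Kx xmin] := lsc_compact_min (@compact_eball _ _ c M) _ lsch.
  by exists x0; exact: coer.
exists x => y; have [yM|yM] := leP (enorm (y - c)) M; first exact: xmin.
have [/coer|/ltW x0y] := leP (h y) (h x0); first by rewrite leNgt yM.
by apply: le_trans x0y; apply: xmin => /=; exact: coer.
Qed.

(** Convexity carries the minimum over the unit ball around [x0] outwards as a linear lower bound.
    It takes the role of an affine minorant in the coercivity argument for [prox]. *)
Lemma convex_lsc_lower_bound d (h : 'rV[R]_d -> \bar R) (x0 : 'rV[R]_d) (r : R) :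
  convex_efun h -> (forall x, h x != -oo) -> lower_semicontinuous h ->
  h x0 = r%:E ->
  exists2 m : R, (0 <= m)%R & forall y, (r - m * (1 + enorm (y - x0)))%:E <= h y.
Proof.
move=> cvx hNy lsch hx0.
have x00 : enorm (x0 - x0) = 0%R :> R.
  by rewrite subrr -(scale0r 0%R) enormZ normr0 mul0r.
have [|x Kx xmin] := lsc_compact_min (@compact_eball _ _ x0 1) _ lsch.
  by exists x0 => /=; rewrite x00.
have xr : h x <= r%:E by rewrite -hx0; apply: xmin => /=; rewrite x00.
case Ex : (h x) (hNy x) xr => [m0| |] // _; rewrite lee_fin => m0r.
exists (r - m0)%R => [|y]; first by rewrite subr_ge0.
have ny0 := enorm_ge0 (y - x0).
have [yM|yM] := leP (enorm (y - x0)) 1%R.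
  apply: le_trans (xmin y yM); rewrite Ex lee_fin.
  have : (0 <= (r - m0) * enorm (y - x0))%R by rewrite mulr_ge0// subr_ge0.
  lra.
set D := enorm (y - x0) in ny0 yM *.
have D0 : (0 < D)%R by lra.
have t01 : (0 <= D^-1 <= 1)%R by rewrite invr_ge0 invf_le1 ?ny0 ?ltW.
(* The weight [D^-1] puts [u] on the unit sphere around [x0], where [h x] is a lower bound. *)
have := cvx y x0 D^-1%R t01; set u := (_ + _)%R => hu.
have : h x <= h u.
  apply: xmin => /=.
  have -> : (u - x0 = D^-1 *: (y - x0))%R.
    by rewrite /u scalerBl scale1r scalerBr addrA addrAC addrK.
  by rewrite enormZ ger0_norm ?mulVf ?gt_eqF//; lra.
move=> /le_trans/(_ hu); rewrite Ex hx0.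
case Ey : (h y) (hNy y) => [s| |] // _; last by rewrite leey.
rewrite -!EFinM -EFinD !lee_fin -(ler_pM2l D0) mulrDr !mulrA divff ?gt_eqF//.
by rewrite mulrBr mulr1 divff ?gt_eqF//; lra.
Qed.

End LowerSemicontinuity.

(** Stands in for the limit of [t] to 0 from above. If [B < A] and [0 < c], the [t] chosen below has
    [t * c = (1 - t) * (A - B)], which is less than [A - B]. *)
Lemma ler_of_ler_mulr (R : realFieldType) (A B c : R) :
  (forall t, 0 < t <= 1 -> A <= B + t * c) -> A <= B.
Proof.
move=> h; rewrite leNgt; apply/negP => BA.
have [c0|c0] := leP c 0; first by have := h 1; rewrite ltr01 lexx; move=> /(_ isT); lra.
have cAB : 0 < c + (A - B) by lra.
pose t := (A - B) / (c + (A - B)).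
have tE : t * (c + (A - B)) = A - B by rewrite /t divfK// gt_eqF.
have t0 : 0 < t by rewrite divr_gt0//; lra.
have t1 : t <= 1 by rewrite ler_pdivrMr//; lra.
have : 0 < t * (A - B) by rewrite mulr_gt0//; lra.
by have := h t; rewrite t0 t1 => /(_ isT); lra.
Qed.

(** * Existence, subgradient inequality and Lipschitz continuity of the proximal map *)

Section Prox.
Context {R : realType} {d : nat}.
Local Notation V := 'rV[R]_d.
Variables (rho lambda : R) (phi : V -> \bar R).
Hypothesis rho_gt0 : 0 < rho.
Hypothesis phi_wconv : weakly_convex rho phi.
Hypothesis phi_lsc : lower_semicontinuous phi.
Hypothesis phi_proper : proper_efun phi.
Hypothesis lambda_gt0 : 0 < lambda.
Hypothesis lambda_rho : lambda * rho < 1.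
Implicit Types (x y z : V).

Let invlambdaE : lambda^-1 = 2 * (2 * lambda)^-1.
Proof. by rewrite invfM mulrA divff ?mul1r. Qed.

Lemma edom_fin x : edom phi x -> phi x = (fine (phi x))%:E.
Proof.
move=> xdom; rewrite fineK// fin_numE (proj1 phi_proper) /=.
by move: xdom; rewrite /edom/= ltey.
Qed.

Lemma prox_argmin_neq0 z :
  argmin (fun y => phi y + ((2 * lambda)^-1 * enorm (z - y) ^+ 2)%:E)%E !=set0.
Proof.
have [phiNy [x0 x0dom]] := phi_proper.
pose h : V -> \bar R := (fun x => phi x + (rho / 2 * enorm x ^+ 2)%:E)%E.
have cn (c : R) (u : V) : continuous (fun y => c * enorm (u - y) ^+ 2).
  under eq_fun do rewrite enormB expr2.
  move=> y; apply: (@cvgM _ _ _ (nbhs_filter y)); first exact: cvg_cst.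
  by apply: (@cvgM _ _ _ (nbhs_filter y)); exact: enormB_continuous.
have hlsc : lower_semicontinuous h.
  apply: lsc_addr => //; have := cn (rho / 2) 0.
  by under eq_fun do rewrite sub0r enormN.
have hNy x : h x != -oo%E.
  by rewrite /h; have := phiNy x; case: (phi x).
set r0 := fine (phi x0).
have hx0 : h x0 = (r0 + rho / 2 * enorm x0 ^+ 2)%:E by rewrite /h edom_fin.
have [m m0 hm] := convex_lsc_lower_bound phi_wconv hNy hlsc hx0.
(* The curvature that remains once the proximal quadratic has paid for the one added to [phi]. It
   dominates the at most linear decay of [h], so the sublevel set of [x0] is bounded. *)
pose c := (2 * lambda)^-1 - rho / 2.
have c0 : 0 < c.
  rewrite /c subr_gt0 invfM -[ltRHS]mulrC ltr_pM2r// -(ltr_pM2r lambda_gt0).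
  by rewrite mulVf ?gt_eqF// mulrC.
pose B := rho * enorm x0 + enorm (z - x0) / lambda.
have B0 : 0 <= B.
  by rewrite addr_ge0 ?mulr_ge0 ?invr_ge0 ?enorm_ge0 ?ltW.
apply: (@lsc_argmin _ _ _ x0 x0 (1 + (m + B + m) / c)); first exact: lsc_addr.
move=> y; rewrite (edom_fin x0dom) -/r0 {hx0}.
have := hm y; rewrite /h; case: (phi y) => [s| |] //=.
rewrite -!EFinD !lee_fin => h1 h2.
set t := enorm (y - x0) in h1 *.
have t0 : 0 <= t by exact: enorm_ge0.
have yx : y = x0 + (y - x0) by rewrite addrC subrK.
have e1 : enorm y ^+ 2 <= enorm x0 ^+ 2 + 2 * enorm x0 * t + t ^+ 2.
  by rewrite [in leLHS]yx enormD_sqr; have := edot_le x0 (y - x0); rewrite -/t; lra.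
have e2 : enorm (z - x0) ^+ 2 - 2 * enorm (z - x0) * t + t ^+ 2 <= enorm (z - y) ^+ 2.
  have -> : z - y = (z - x0) - (y - x0) by rewrite opprB addrA subrK.
  by rewrite [leRHS]enormB_sqr; have := edot_le (z - x0) (y - x0); rewrite -/t; lra.
have key : c * t ^+ 2 <= m + B * t + m * t.
  have k0 : 0 <= (2 * lambda)^-1 by rewrite invr_ge0 mulr_ge0// ltW.
  have r20 : 0 <= rho / 2 by rewrite divr_ge0// ltW.
  have := ler_wpM2l r20 e1; have := ler_wpM2l k0 e2.
  by rewrite /c /B invlambdaE; lra.
have [t1|t1] := leP t 1.
  by apply: le_trans t1 _; rewrite lerDl divr_ge0 ?(ltW c0)//; lra.
apply: (@le_trans _ _ ((m + B + m) / c)); last by rewrite lerDr.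
rewrite ler_pdivlMr// -(ler_pM2l (lt_trans ltr01 t1)).
have mt : m <= m * t by rewrite ler_peMr// ltW.
have tc : t * (t * c) = c * t ^+ 2 by ring.
by rewrite tc (le_trans key)//; lra.
Qed.


Lemma prox_min z y :
  (phi (prox lambda phi z) + ((2 * lambda)^-1 * enorm (z - prox lambda phi z) ^+ 2)%:E
     <= phi y + ((2 * lambda)^-1 * enorm (z - y) ^+ 2)%:E)%E.
Proof.
have [x xmin] := prox_argmin_neq0 z.
exact: (xgetI 0 xmin) y.
Qed.

Lemma prox_edom z : edom phi (prox lambda phi z).
Proof.
have [_ [x0 x0dom]] := phi_proper; rewrite /edom/=.
have := prox_min z x0; rewrite (edom_fin x0dom).
by case: (phi _) => [r| |]; rewrite ?ltry// ltNyr.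
Qed.

(* Compare the prox objective at [w] and at [w + t (y - w)], use weak convexity
   and let [t] go to [0]. *)
Lemma prox_subgradient z y : edom phi y ->
  fine (phi (prox lambda phi z))
      + lambda^-1 * edot (z - prox lambda phi z) (y - prox lambda phi z)
      - rho / 2 * enorm (y - prox lambda phi z) ^+ 2
    <= fine (phi y).
Proof.
set w := prox _ _ z => ydom; have wdom : edom phi w := prox_edom z.
pose q := enorm (y - w) ^+ 2.
suff : fine (phi w) + lambda^-1 * edot (z - w) (y - w) <= fine (phi y) + rho / 2 * q.
  by rewrite /q; lra.
apply: (@ler_of_ler_mulr _ _ _ ((2 * lambda)^-1 * q - rho / 2 * q)) => t /andP[t0 t1].
pose u := t *: y + (1 - t) *: w.
have t01 : (0 <= t <= 1)%R by rewrite ltW.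
have hu := phi_wconv y w t01; rewrite /= -/u (edom_fin ydom) (edom_fin wdom) in hu.
have udom : edom phi u.
  by move: hu; rewrite /edom/=; case: (phi u) => [s| |]; rewrite ?ltry ?ltNyr.
rewrite (edom_fin udom) -!EFinD lee_fin in hu.
have := prox_min z u; rewrite -/w (edom_fin udom) (edom_fin wdom) -!EFinD lee_fin => mu.
have uE : u = w + t *: (y - w).
  by rewrite /u scalerBl scale1r scalerBr addrCA addrC -addrA addrCA addrC.
have yE : y = w + (y - w) by rewrite addrC subrK.
have zuE : z - u = (z - w) - t *: (y - w) by rewrite uE opprD addrA.
have tn : enorm (t *: (y - w)) ^+ 2 = t ^+ 2 * q.
  by rewrite enormZ exprMn real_normK ?num_real.
rewrite zuE (enormB_sqr (z - w)) tn edotZr in mu.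
have yn : enorm y ^+ 2 = enorm w ^+ 2 + 2 * edot w (y - w) + q.
  by rewrite [in LHS]yE enormD_sqr.
have un : enorm u ^+ 2 = enorm w ^+ 2 + 2 * (t * edot w (y - w)) + t ^+ 2 * q.
  by rewrite uE enormD_sqr tn edotZr.
rewrite un yn in hu.
by rewrite -(ler_pM2l t0) invlambdaE; lra.
Qed.

(** Sum of two subgradient inequalities, each tested at the other proximal point; their curvature
    terms add up to the loss [lambda * rho]. *)
Lemma prox_monotone z z' :
  (1 - lambda * rho) * enorm (prox lambda phi z' - prox lambda phi z) ^+ 2
    <= edot (z' - z) (prox lambda phi z' - prox lambda phi z).
Proof.
have := prox_subgradient z (prox_edom z').
have := prox_subgradient z' (prox_edom z).
set w := prox _ _ z; set w' := prox _ _ z' => h2 h1.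
have -> : z' - z = (z' - w') - (z - w) + (w' - w).
  by apply/rowP => i; rewrite !mxE; ring.
rewrite (enormB w) -(opprB w' w) edotNr in h2.
rewrite (edotDl (z' - w' - (z - w))) (edotDl (z' - w')) edotNl -(enorm_sqr (w' - w)).
set A := edot (z' - w') _ in h2 *; set B := edot (z - w) _ in h1 *.
set q := enorm _ ^+ 2 in h1 h2 *.
have : lambda^-1 * (B - A) <= rho * q by lra.
by rewrite ler_pdivrMl//; lra.
Qed.

Lemma prox_lipschitz z z' :
  enorm (prox lambda phi z' - prox lambda phi z) <= (1 - lambda * rho)^-1 * enorm (z' - z).
Proof.
have x0 : 0 < 1 - lambda * rho by rewrite subr_gt0.
have := le_trans (prox_monotone z z') (edot_le _ _).
have [->|n0] := eqVneq (enorm (prox lambda phi z' - prox lambda phi z)) 0.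
  by rewrite mulr_ge0 ?enorm_ge0// invr_ge0 ltW.
have np : 0 < enorm (prox lambda phi z' - prox lambda phi z).
  by rewrite lt_def n0 enorm_ge0.
by rewrite expr2 mulrA ler_pM2r// -ler_pdivlMl.
Qed.

End Prox.

(** * Gradients and the PL condition *)

Section Gradient.
Context {R : realType} {d : nat}.
Implicit Types (g : 'rV[R]_d -> R) (x y v : 'rV[R]_d).

Lemma derive_grad g x v : differentiable g x -> 'D_v g x = edot (grad g x) v.
Proof.
move=> gx; rewrite deriveE// [in LHS](row_sum_delta v) linear_sum.
by apply: eq_bigr => j _; rewrite linearZ mxE deriveE// mulrC.
Qed.

Lemma is_derive_line g x v (t : R) : differentiable g (x + t *: v) ->
  is_derive t 1 (fun s => g (x + s *: v)) (edot (grad g (x + t *: v)) v).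
Proof.
move=> gx; have e : (fun h : R => h^-1 *: (g (x + (h *: 1 + t) *: v) - g (x + t *: v))) =
    (fun h : R => h^-1 *: (g (h *: v + (x + t *: v)) - g (x + t *: v))).
  apply/funext => h; congr (_ *: (g _ - _)).
  by rewrite scalerDl [h *: 1]mulr1 addrCA.
have dg := @diff_derivable _ _ _ g _ v gx.
split; first by move: dg; rewrite /derivable -e.
by rewrite -derive_grad// /derive -e.
Qed.

Lemma differentiable_grad_near g x (e : R) : differentiable g x -> 0 < e ->
  \forall y \near x, g x + edot (grad g x) (y - x) - e * enorm (y - x) <= g y.
Proof.
move=> gx e0.
have := diff_locally gx; move=> /eqaddoP/(_ _ e0).
move=> near0; apply/nbhs0P; apply: filterS near0 => h /=.
rewrite -[(_ - _) h]/(g (h + x) - (g x + 'd g x h)) [x + h]addrC addrK.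
rewrite -derive_grad// deriveE// => /ler_normlP[+ _].
(* The remainder is measured in the sup norm, which the Euclidean norm dominates. *)
have := ler_wpM2l (ltW e0) (norm_le_enorm h); lra.
Qed.

(** The mean value theorem is applied to the defect [k], whose derivative is nonpositive along the
    segment. The Lipschitz bound holds on [D] only, in the application the domain of [phi], so the
    segment has to stay in it. *)
Lemma descent_lemma g (D : set 'rV[R]_d) (L : R) x y : 0 <= L ->
  (forall u, differentiable g u) ->
  (forall t, 0 <= t <= 1 -> D (x + t *: (y - x))) ->
  (forall u v, D u -> D v -> enorm (grad g u - grad g v) <= L * enorm (u - v)) ->
  g y <= g x + edot (grad g x) (y - x) + L / 2 * enorm (y - x) ^+ 2.
Proof.
move=> L0 gd segD glip; set v := y - x; set q := enorm v ^+ 2.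
pose k (t : R) := g (x + t *: v) - edot (grad g x) v * t - L / 2 * q * t ^+ 2.
pose dk (t : R) := edot (grad g (x + t *: v)) v - edot (grad g x) v - L * q * t.
have kd (t : R) : is_derive t 1 k (dk t).
  have h1 := @is_derive_line g x v t (gd _).
  have h2 := @is_deriveB _ _ _ _ _ _ _ _ _ (@is_deriveB _ _ _ _ _ _ _ _ _ h1
    (@is_deriveZ _ _ _ _ (edot (grad g x) v) _ _ _ (is_derive_id t 1)))
    (@is_deriveZ _ _ _ _ (L / 2 * q) _ _ _ (@is_deriveX _ _ id 2 t 1 _ (is_derive_id t 1))).
  apply: (@is_derive_eq _ _ _ _ _ _ _ _ h2).
  rewrite /dk; set G := edot (grad g (x + _)) v.
  by rewrite /GRing.scale/= expr1; lra.
have kc : {within `[0, 1], continuous k}.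
  apply: continuous_subspaceT => t.
  by apply: differentiable_continuous; apply/derivable1_diffP; apply: ex_derive.
have [c /andP[c0 c1]] := @MVT R k dk 0 1 ltr01 (fun t _ => kd t) kc.
rewrite subr0 mulr1 /k /dk scale0r addr0 scale1r mulr0 mulr1 expr0n/= mulr0 expr1n !subr0.
have -> : x + v = y by rewrite addrC subrK.
rewrite !bnd_simp in c0 c1.
have d0 : D x by have := segD 0; rewrite scale0r addr0 lexx ler01; exact.
have d1 : D (x + c *: v) by apply: segD; rewrite !ltW.
have := edot_le (grad g (x + c *: v) - grad g x) v.
have := ler_wpM2r (enorm_ge0 v) (glip _ _ d1 d0).
rewrite addrAC subrr add0r enormZ (gtr0_norm c0) edotDl edotNl.
have -> : L * (c * enorm v) * enorm v = L * c * q by rewrite /q; ring.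
by move=> h1 h2 h3; lra.
Qed.

End Gradient.

(** * Quadratic growth from the PL inequality *)

Section QuadraticGrowth.
Context {R : realType} {d : nat}.
Local Notation V := 'rV[R]_d.
Implicit Types (x y : V).

Lemma sqr_dist_set0_le (S : set V) x :
  S x -> (dist_set 0 S ^+ 2 <= (enorm x ^+ 2)%:E)%E.
Proof.
move=> Sx; have dx : (dist_set 0 S <= (enorm x)%:E)%E.
  by rewrite -(enormN x) -sub0r; apply: ereal_inf_lbound; exists x.
have d0 : (0 <= dist_set 0 S)%E.
  by apply: le_ereal_inf_tmp => _ [y _ <-]; rewrite lee_fin enorm_ge0.
by rewrite expe2 expr2 EFinM lee_pmul.
Qed.

Lemma lsc_sqrte (g : V -> \bar R) (c : R) : lower_semicontinuous g ->
  lower_semicontinuous (fun y => sqrte (g y - c%:E)%E).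
Proof.
move=> lscg x a ax; have [a0|a0] := ltP a 0.
  exists setT => [|y _]; first exact: filterT.
  by apply: (@lt_le_trans _ _ 0%E); rewrite ?lte_fin ?sqrte_ge0.
have gx : ((a ^+ 2 + c)%:E < g x)%E.
  case E : (g x) ax => [r| |] /= ; rewrite ?ltry// lte_fin => ax.
    rewrite lte_fin -ltrBrDr.
    have rc : 0 <= r - c.
      by rewrite leNgt; apply/negP => /ltW/ler0_sqrtr rc0; rewrite rc0 ltNge a0 in ax.
    by rewrite -(sqr_sqrtr rc) ltrXn2r// nnegrE ?sqrtr_ge0.
  by rewrite ltNge a0 in ax.
have [W Wx Wg] := lscg x _ gx; exists W => // y /Wg.
case: (g y) => [r| |] //=; rewrite ?ltry// !lte_fin => ar.
rewrite -[ltLHS]ger0_norm// -sqrtr_sqr ltr_sqrt; last first.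
  by have := sqr_ge0 a; lra.
by rewrite ltrBrDr.
Qed.

Variables (g : V -> \bar R) (gs mu : R).
Hypothesis g_lsc : lower_semicontinuous g.
Hypothesis g_ge : forall x, (gs%:E <= g x)%E.
Hypothesis mu_gt0 : 0 < mu.
Hypothesis g_PL : forall x, (g x < +oo)%E ->
  ((2 * mu)%:E * (g x - gs%:E) <= dist_set 0 (frechet_subdiff g x) ^+ 2)%E.

(* Minimize [sqrt (g y - gs) + kappa * sqrt (|y - w|^2 + e^2)] with
   [kappa ^ 2 = mu / 2]. The second summand is smooth with gradients shorter
   than [kappa], so that a minimizer [y] with [g y > gs] would have a subgradient
   violating the PL inequality. *)
Lemma PL_quadratic_growth (w : V) (r e : R) : g w = r%:E -> 0 < e ->
  exists2 y, g y = gs%:E & enorm (w - y) <= Num.sqrt (2 / mu * (r - gs)) + e.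
Proof.
move=> gw e0.
pose q y := Num.sqrt (enorm (y - w) ^+ 2 + e ^+ 2).
have q2 y : q y ^+ 2 = enorm (y - w) ^+ 2 + e ^+ 2.
  by rewrite sqr_sqrtr// addr_ge0 ?sqr_ge0.
have qgt y : enorm (y - w) < q y.
  rewrite -(ltr_pXn2r (n := 2)) ?nnegrE ?enorm_ge0 ?sqrtr_ge0// q2.
  by rewrite ltrDl exprn_gt0.
have q0 y : 0 < q y by apply: le_lt_trans (qgt y); exact: enorm_ge0.
pose kappa := Num.sqrt (mu / 2).
have k0 : 0 < kappa by rewrite sqrtr_gt0 divr_gt0.
have k2 : kappa ^+ 2 = mu / 2 by rewrite sqr_sqrtr// divr_ge0// ltW.
pose G y := (sqrte (g y - gs%:E) + (kappa * q y)%:E)%E.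
have Glsc : lower_semicontinuous G.
  apply: lsc_addr; first exact: lsc_sqrte.
  move=> y; apply: (@cvgM _ _ _ (nbhs_filter y)); first exact: cvg_cst.
  apply: (@continuous_comp _ _ _ (fun y => enorm (y - w) ^+ 2 + e ^+ 2) Num.sqrt).
    apply: (@cvgD _ _ _ _ (nbhs_filter y)); last exact: cvg_cst.
    under eq_fun do rewrite expr2.
    by apply: (@cvgM _ _ _ (nbhs_filter y)); exact: enormB_continuous.
  exact: sqrt_continuous.
have rgs : gs <= r by rewrite -lee_fin -gw.
have sG y : (0 <= sqrte (g y - gs%:E))%E by exact: sqrte_ge0.
pose A := Num.sqrt (r - gs) + kappa * q w.
have Gw : G w = A%:E by rewrite /G gw.
have qw : q w = e.
  by rewrite /q subrr -(scale0r 0) enormZ normr0 mul0r expr0n add0r sqrtr_sqr gtr0_norm.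
have [|y0 y0min] := @lsc_argmin _ _ G w w (A / kappa) Glsc.
  move=> y; rewrite Gw => GyA.
  have : ((kappa * q y)%:E <= A%:E)%E.
    by apply: le_trans GyA; rewrite leeDr.
  rewrite lee_fin => kqA; apply: (le_trans (ltW (qgt y))).
  by rewrite ler_pdivlMr// mulrC.
have := y0min w; rewrite Gw /G.
case Ey : (g y0) (g_ge y0) => [t| |] //=; rewrite -?EFinD !lee_fin => gst hA.
set s0 := Num.sqrt (t - gs) in hA.
have s00 : 0 <= s0 by exact: sqrtr_ge0.
have s02 : s0 ^+ 2 = t - gs by rewrite sqr_sqrtr// subr_ge0.
have [s0z|s0n] := eqVneq s0 0.
  exists y0; first by rewrite Ey; congr (_%:E); move: s02; rewrite s0z expr0n/=; lra.
  rewrite enormB; apply: (le_trans (ltW (qgt y0))).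
  rewrite -(ler_pM2l k0); apply: le_trans (_ : A <= _); first by lra.
  rewrite /A qw mulrDr lerD2r /kappa -sqrtrM ?divr_ge0 ?(ltW mu_gt0)//.
  rewrite mulrA.
  have -> : mu / 2 * (2 / mu) = 1 by field; rewrite gt_eqF.
  by rewrite mul1r.
exfalso; have s0p : 0 < s0 by rewrite lt_def s0n.
(* By minimality the square root of [g y - gs] is at least [s0 - kappa * (q y - q y0)]. Squaring to
   first order, with [(y0 - w) / q y0] as the gradient of [q], yields the subgradient
   [- (c *: (y0 - w))] of [g]. *)
pose c := 2 * s0 * kappa / q y0.
have c0 : 0 < c by rewrite !mulr_gt0 ?invr_gt0.
have xi : frechet_subdiff g y0 (- (c *: (y0 - w))).
  split; first by rewrite Ey.
  move=> eps eps0.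
  (* Within this radius the quadratic remainder [c / 2 * enorm (y - y0) ^+ 2] is at most
     [eps * enorm (y - y0)]. *)
  have b0 : 0 < 2 * eps / c by rewrite !mulr_gt0 ?invr_gt0.
  apply: (@filterS _ (nbhs y0)) (nbhs_enorm y0 b0) => y yy0.
  rewrite Ey; have := y0min y; rewrite /G Ey /= -/s0.
  case Egy : (g y) (g_ge y) => [u| |] //= => [gsu|_ _]; last by rewrite leey.
  rewrite -?EFinD !lee_fin in gsu *; set sy := Num.sqrt (u - gs) => hmin.
  have sy2 : sy ^+ 2 = u - gs by rewrite sqr_sqrtr// subr_ge0.
  have yw : q y ^+ 2 = q y0 ^+ 2 + 2 * edot (y0 - w) (y - y0) + enorm (y - y0) ^+ 2.
    have E : y - w = (y0 - w) + (y - y0) by rewrite [RHS]addrC addrA subrK.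
    by rewrite !q2 {1}E enormD_sqr; lra.
  rewrite edotNl edotZl; rewrite ltr_pdivlMr// in yy0.
  have h1 : 0 <= (sy - s0) ^+ 2 by exact: sqr_ge0.
  have h2 : 0 <= c / 2 * (q y - q y0) ^+ 2 by rewrite mulr_ge0 ?sqr_ge0// divr_ge0// ltW.
  have h3 : 2 * s0 * (s0 + kappa * q y0) <= 2 * s0 * (sy + kappa * q y).
    by rewrite ler_wpM2l// mulr_ge0.
  have h4 : c * q y0 = 2 * s0 * kappa by rewrite /c divfK// gt_eqF.
  have h5 : enorm (y - y0) * (enorm (y - y0) * c) <= enorm (y - y0) * (2 * eps).
    by rewrite ler_wpM2l ?enorm_ge0// ltW.
  have h6 : c * q y ^+ 2 = c * (q y0 ^+ 2 + 2 * edot (y0 - w) (y - y0) + enorm (y - y0) ^+ 2).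
    by rewrite yw.
  have h7 : c * q y0 * q y = 2 * s0 * kappa * q y by rewrite h4.
  have h8 : c * q y0 * q y0 = 2 * s0 * kappa * q y0 by rewrite h4.
  clear -sy2 s02 h1 h2 h3 h5 h6 h7 h8; lra.
have := le_trans (g_PL _) (sqr_dist_set0_le xi); rewrite Ey ltry => /(_ isT).
rewrite -EFinB -EFinM lee_fin enormN enormZ gtr0_norm// exprMn -s02.
rewrite leNgt => /negP; apply.
(* Thanks to [kappa ^+ 2 = mu / 2] the PL inequality would say that [q y0] is at most
   [enorm (y0 - w)], and the smoothing by [e] makes it strictly larger. *)
have -> : 2 * mu * s0 ^+ 2 = c ^+ 2 * q y0 ^+ 2.
  by rewrite -exprMn /c divfK ?gt_eqF// !exprMn k2; field.
by rewrite ltr_pM2l ?exprn_gt0// ltr_pXn2r ?nnegrE ?enorm_ge0 ?(ltW (q0 _)).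
Qed.

End QuadraticGrowth.

(** * Decrease of the merit function along an inexact step *)

Section NormalMapStep.
Context {R : realType} {d : nat}.

(** Scalar core of the next lemma: [p2], [e2], [d2], [g2], [q] stand for squared norms, [pe], [pg],
    [pd], [ed] for inner products. The estimates leave [d2] with a coefficient of at most
    [11 / 25 + 1 / 20 - 1 / 2 + 3 / 8 * a], negative for [a <= 128^-1], and [p2] with at most
    [tau * (- 1 + 1 / 8 + 1 / 2)]. *)
Lemma merit_step_bound_real (a x y tau b p2 e2 d2 g2 q pe pg pd ed : R) :
  0 < a -> a <= 128^-1 -> 0 <= x -> x <= 4^-1 -> b <= 10^-1 -> 0 < tau -> tau <= 2^-1 ->
  tau * (1 + y) <= 2^-1 -> tau * (2 * (1 - 2 * x + y)) = 1 - 4 * x ->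
  0 <= p2 -> 0 <= e2 -> 0 <= d2 ->
  (1 - x) * d2 <= ed - pd -> g2 <= y * d2 ->
  pe <= p2 / 8 + 2 * e2 -> pg <= p2 / 2 + g2 / 2 ->
  ed <= 11 / 25 * d2 + 25 / 44 * e2 -> q <= 3 * (e2 + g2 + d2) ->
  (1 - a) * pd + a * ed - (a - (b + a * x) / 2) * d2
    + tau * ((a / 2 - 1) * p2 + (1 - a) * (pe + pg - pd) + a / 2 * q)
  <= - (3 / 8 * tau) * p2 + 8 / 5 * e2.
Proof.
move=> a0 a1 x0 x1 b1 t0 t1 ty tE p0 e0 d0 mono hg hpe hpg hed hq.
have at0 : 0 <= (1 - a) * (1 - tau) by rewrite mulr_ge0//; lra.
have m1 := ler_wpM2l at0 mono.
have k0 : 0 <= (1 - a) * (1 - tau) + a by lra.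
have k1 : (1 - a) * (1 - tau) + a <= 1.
  by have : 0 <= (1 - a) * tau by [rewrite mulr_ge0//; lra]; lra.
have m2 := ler_wpM2l k0 hed.
have m2' : ((1 - a) * (1 - tau) + a) * (11 / 25 * d2 + 25 / 44 * e2)
    <= 11 / 25 * d2 + 25 / 44 * e2 by rewrite ler_piMl//; lra.
have ta0 : 0 <= tau * (1 - a) by rewrite mulr_ge0//; lra.
have m3 : tau * (1 - a) * (pe + pg) <= tau * (1 - a) * (5 / 8 * p2 + 2 * e2 + y * d2 / 2).
  by rewrite ler_wpM2l//; lra.
have ta1 : 0 <= tau * (a / 2) by rewrite mulr_ge0//; lra.
have m4 : tau * (a / 2) * q <= tau * (a / 2) * (3 * (e2 + (1 + y) * d2)).
  by rewrite ler_wpM2l//; lra.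
have ad0 : 0 <= 3 / 2 * a * d2 by rewrite !mulr_ge0//; lra.
have m5 := ler_wpM2l ad0 ty.
(* Here the formula of [tau] enters: by [tE] the right-hand side equals [3 / 4 - tau / 2]. *)
have br : 2^-1 <= (1 - tau) * (1 - x) - tau * y / 2 by lra.
have ad1 : 0 <= (1 - a) * d2 by rewrite mulr_ge0//; lra.
have m6 := ler_wpM2l ad1 br.
have m7 : a * x * d2 <= a * 4^-1 * d2 by rewrite ler_wpM2r// ler_wpM2l// ltW.
have m8 : b * d2 <= 10^-1 * d2 by rewrite ler_wpM2r.
have m9 : a * d2 <= 128^-1 * d2 by rewrite ler_wpM2r.
have m10 : tau * e2 <= 2^-1 * e2 by rewrite ler_wpM2r.
have m11 : 0 <= a * (tau * e2) by rewrite !mulr_ge0// ltW.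
have m12 : 0 <= a * (tau * p2) by rewrite !mulr_ge0// ltW.
lra.
Qed.

(* With [P = alpha F(z)], [D = w' - w], [G = lambda (grad f w' - grad f w)] and
   [a = alpha / lambda], the left-hand side bounds [alpha] times the change of the
   merit function along [z' - z = - P + e]. Part of the cross term [<P, D>] is
   turned into a negative multiple of [|D|^2] by monotonicity. *)
Lemma merit_step_bound (a x l tau b : R) (P P' e D G : 'rV[R]_d) :
  P' = (1 - a) *: P + a *: (e + G - D) ->
  0 < a <= 128^-1 -> 0 <= x <= 4^-1 -> b <= 10^-1 -> 0 < tau <= 2^-1 ->
  tau * (1 + l ^+ 2) <= 2^-1 -> tau * (2 * (1 - 2 * x + l ^+ 2)) = 1 - 4 * x ->
  (1 - x) * enorm D ^+ 2 <= edot (e - P) D -> enorm G <= l * enorm D ->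
  (1 - a) * edot P D + a * edot e D - (a - (b + a * x) / 2) * enorm D ^+ 2
    + tau / (2 * a) * (enorm P' ^+ 2 - enorm P ^+ 2)
  <= - (3 / 8 * tau) * enorm P ^+ 2 + 8 / 5 * enorm e ^+ 2.
Proof.
move=> -> /andP[a0 a1] /andP[x0 x1] b1 /andP[t0 t1] tl tE mono lip.
have := sqr_enorm_le lip; rewrite -!enorm_sqr => G2.
set q := enorm (e + G - D) ^+ 2.
have ED : enorm ((1 - a) *: P + a *: (e + G - D)) ^+ 2 = (1 - a) ^+ 2 * enorm P ^+ 2
   + 2 * a * (1 - a) * (edot P e + edot P G - edot P D) + a ^+ 2 * q.
  rewrite enormD_sqr !enormZ !exprMn !real_normK ?num_real// -/q edotZl edotZr.
  by rewrite !edotDr edotNr; lra.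
rewrite ED {ED}.
have pos c : (0 < c)%N -> 0 < c%:R^-1 :> R by rewrite invr_gt0 ltr0n.
have pe := edot_young P e (pos 4%N isT).
have pg := edot_young P G ltr01.
have ed := edot_young D e (mulr_gt0 (ltr0n R 22) (pos 25%N isT)).
have hq : q <= 3 * (enorm e ^+ 2 + enorm G ^+ 2 + enorm D ^+ 2).
  by rewrite /q -(enormN D) !enorm_sqr edot_add3_le.
rewrite -!enorm_sqr invrK in pe; rewrite -!enorm_sqr invr1 in pg.
rewrite -!enorm_sqr invf_div (edotC D) in ed; rewrite edotDl edotNl in mono.
have -> : tau / (2 * a) * ((1 - a) ^+ 2 * enorm P ^+ 2
      + 2 * a * (1 - a) * (edot P e + edot P G - edot P D) + a ^+ 2 * q - enorm P ^+ 2)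
    = tau * ((a / 2 - 1) * enorm P ^+ 2
        + (1 - a) * (edot P e + edot P G - edot P D) + a / 2 * q).
  by field; rewrite gt_eqF.
apply: (merit_step_bound_real a0 a1 x0 x1 b1 t0 t1 tl tE _ _ _ mono G2 _ _ _ hq).
- exact: sqr_ge0.
- exact: sqr_ge0.
- exact: sqr_ge0.
- by clear -pe; lra.
- by clear -pg; lra.
- by clear -ed; lra.
Qed.

End NormalMapStep.

(** * Reshuffling error of one epoch *)

Section Reshuffling.
Context {R : realType} {d n : nat}.
Local Notation V := 'rV[R]_d.

Lemma sum_ord_le m : \sum_(k < m) k%:R <= m%:R ^+ 2 / 2 :> R.
Proof.
elim: m => [|m IH]; first by rewrite big_ord0 expr0n mul0r.
by rewrite big_ord_recr/= -natr1; lra.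
Qed.

Lemma sum_ord_sqr_le m : \sum_(k < m) k%:R ^+ 2 <= m%:R ^+ 3 / 3 :> R.
Proof.
elim: m => [|m IH]; first by rewrite big_ord0 expr0n mul0r.
rewrite big_ord_recr/= -natr1; have : 0 <= m%:R :> R by [].
lra.
Qed.

Lemma card_ord_lt (k : nat) : (k <= n)%N -> #|[pred i : 'I_n | i < k]%N| = k.
Proof.
move=> kn; rewrite -sum1_card -(big_ord_widen n (fun _ => 1%N) kn).
by rewrite sum1_card card_ord.
Qed.

Lemma sum_perm (W : nmodType) (g : 'I_n -> W) (s : 'S_n) :
  \sum_(i < n) g (s i) = \sum_(i < n) g i.
Proof. by rewrite [RHS](reindex_inj (@perm_inj _ s)). Qed.

Definition partial_sum (v : 'I_n -> V) (s : 'S_n) (k : nat) : V :=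
  \sum_(i < n | (i < k)%N) v (s i).

Lemma partial_sum_le (v : 'I_n -> V) s k : (k <= n)%N ->
  enorm (partial_sum v s k) ^+ 2 <= k%:R * \sum_(i < n) enorm (v i) ^+ 2.
Proof.
move=> kn; rewrite enorm_sqr.
apply: le_trans (edot_sum_le [pred i : 'I_n | i < k]%N (fun i => v (s i))) _.
rewrite card_ord_lt// ler_wpM2l//.
rewrite -(sum_perm (fun j => enorm (v j) ^+ 2) s) [leRHS](bigID [pred i : 'I_n | i < k]%N)/=.
under eq_bigr do rewrite -enorm_sqr.
by rewrite lerDl sumr_ge0// => i _; rewrite sqr_ge0.
Qed.

(** Composing with a transposition shows that all positions contribute equally, and for a fixed [s]
    the sum over all positions does not depend on [s]. *)
Lemma sum_perm_edot_diag (v : 'I_n -> V) (i : 'I_n) :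
  n%:R * \sum_(s : 'S_n) edot (v (s i)) (v (s i))
    = n`!%:R * \sum_(j < n) enorm (v j) ^+ 2.
Proof.
have sym j : \sum_(s : 'S_n) edot (v (s j)) (v (s j)) =
    \sum_(s : 'S_n) edot (v (s i)) (v (s i)).
  rewrite [LHS](reindex_inj (mulgI (tperm i j))).
  by apply: eq_bigr => s _; rewrite permM tpermR.
have -> : n%:R * \sum_(s : 'S_n) edot (v (s i)) (v (s i)) =
    \sum_(j < n) \sum_(s : 'S_n) edot (v (s j)) (v (s j)).
  by rewrite (eq_bigr _ (fun j _ => sym j)) sumr_const card_ord mulr_natl.
rewrite exchange_big/= -card_Sn mulr_natl -sumr_const; apply: eq_bigr => s _.
by rewrite -[RHS](sum_perm (fun j => enorm (v j) ^+ 2) s); apply: eq_bigr => j _;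
  rewrite enorm_sqr.
Qed.

(* By symmetry the sum does not depend on [j != i], and together with the
   diagonal these sums add up to [0]. *)
Lemma sum_perm_edot_offdiag (v : 'I_n -> V) (i j : 'I_n) :
  \sum_(i < n) v i = 0 -> i != j ->
  \sum_(s : 'S_n) edot (v (s i)) (v (s j)) <= 0.
Proof.
move=> v0 ij.
have sym m : m != i -> \sum_(s : 'S_n) edot (v (s i)) (v (s m)) =
    \sum_(s : 'S_n) edot (v (s i)) (v (s j)).
  move=> mi; rewrite [LHS](reindex_inj (mulgI (tperm j m))).
  by apply: eq_bigr => s _; rewrite !permM tpermR tpermD// eq_sym.
have tot : \sum_(m < n) \sum_(s : 'S_n) edot (v (s i)) (v (s m)) = 0.
  rewrite exchange_big/=; apply: big1 => s _; rewrite -edot_sumr.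
  by rewrite sum_perm v0 edotC edot0l.
rewrite leNgt; apply/negP => pos.
move: tot; rewrite (bigD1 i)//= (bigD1 j) 1?eq_sym//= => /eqP; apply/negP.
rewrite gt_eqF// addrA ltr_wpDr//.
  by apply: sumr_ge0 => m /andP[mi _]; rewrite sym// ltW.
by rewrite ltr_wpDl//; apply: sumr_ge0 => s _; exact: edot_ge0.
Qed.

Lemma sum_perm_partial_sum_le (v : 'I_n -> V) k : (0 < n)%N -> (k <= n)%N ->
  \sum_(i < n) v i = 0 ->
  \sum_(s : 'S_n) enorm (partial_sum v s k) ^+ 2
    <= n`!%:R * (k%:R * (n%:R^-1 * \sum_(i < n) enorm (v i) ^+ 2)).
Proof.
move=> n0 kn v0; have nR : n%:R != 0 :> R by rewrite pnatr_eq0 -lt0n.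
under eq_bigr do rewrite enorm_sqr edot_suml.
rewrite exchange_big/=.
apply: (@le_trans _ _ (\sum_(i < n | (i < k)%N)
    \sum_(s : 'S_n) edot (v (s i)) (v (s i)))).
  apply: ler_sum => i ik; under eq_bigr do rewrite edot_sumr.
  rewrite exchange_big/= (bigD1 i)//= gerDl; apply: sumr_le0 => j /andP[_ ji].
  by apply: sum_perm_edot_offdiag => //; rewrite eq_sym.
rewrite le_eqVlt; apply/orP; left; apply/eqP.
have diag i : \sum_(s : 'S_n) edot (v (s i)) (v (s i)) =
    n`!%:R * (n%:R^-1 * \sum_(i < n) enorm (v i) ^+ 2).
  by apply: (mulfI nR); rewrite sum_perm_edot_diag mulrCA mulVKf.
rewrite (eq_bigr _ (fun i _ => diag i)).
by rewrite sumr_const card_ord_lt// -[LHS]mulr_natl; ring.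
Qed.

(** The first [k] directions sum to deviations from their values at [z 0], plus [k *: Fz], plus a
    centred partial sum. At the end of the epoch the centred sum is zero and [alpha *: Fz] cancels
    the mean part; only deviations remain, and the displacements [z k - z 0] control them. *)
Lemma epoch_error (F : 'I_n -> V -> V) (K alpha : R) (s : 'S_n) (z : nat -> V)
    (Fz : V) (v := fun i => F i (z 0%N) - Fz)
    (S := n%:R ^- 3 * \sum_(k < n) enorm (partial_sum v s k) ^+ 2) :
  (0 < n)%N -> 0 <= K ->
  (forall i x y, enorm (F i x - F i y) <= K * enorm (x - y)) ->
  (forall i : 'I_n, z i.+1 = z i - (alpha / n%:R) *: F (s i) (z i)) ->
  Fz = n%:R^-1 *: \sum_(i < n) F i (z 0%N) ->
  8 * K ^+ 2 * alpha ^+ 2 <= 1 ->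
  enorm (z n - z 0%N + alpha *: Fz) ^+ 2
    <= 5 / 3 * K ^+ 2 * alpha ^+ 4 * (enorm Fz ^+ 2 + 3 * S).
Proof.
move=> n0 K0 Flip zS FzE Kalpha.
have nR : n%:R != 0 :> R by rewrite pnatr_eq0 -lt0n.
have nRp : 0 < n%:R :> R by rewrite ltr0n.
pose dev i := F (s i) (z i) - F (s i) (z 0%N).
have zk k : (k <= n)%N ->
    z k = z 0%N - (alpha / n%:R) *: \sum_(i < n | (i < k)%N) F (s i) (z i).
  elim: k => [_|k IH kn]; first by rewrite big_pred0// scaler0 subr0.
  rewrite (zS (Ordinal kn)) [X in X - _]IH 1?ltnW// -addrA -opprD -scalerDr.
  congr (_ - _ *: _); rewrite [RHS](bigD1 (Ordinal kn)) ?ltnSn//= addrC.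
  congr (_ + _); apply: eq_bigl => i; rewrite ltnS -val_eqE/=.
  by rewrite ltn_neqAle andbC.
have Fk k : (k <= n)%N -> \sum_(i < n | (i < k)%N) F (s i) (z i) =
    \sum_(i < n | (i < k)%N) dev i + k%:R *: Fz + partial_sum v s k.
  move=> kn; rewrite /partial_sum /dev /v -addrA [k%:R *: _ + _]addrC.
  have -> : k%:R *: Fz = \sum_(i < n | (i < k)%N) Fz.
    by rewrite sumr_const card_ord_lt// scaler_nat.
  rewrite -!big_split; apply: eq_bigr => i _ /=.
  by rewrite subrK subrK.
pose A := n%:R^-1 * \sum_(i < n) enorm (z i - z 0%N) ^+ 2.
have A0 : 0 <= A.
  by rewrite mulr_ge0 ?invr_ge0// sumr_ge0// => i _; rewrite sqr_ge0.
have dev2 i : edot (dev i) (dev i) <= K ^+ 2 * enorm (z i - z 0%N) ^+ 2.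
  by rewrite [enorm _ ^+ 2]enorm_sqr; apply: sqr_enorm_le; exact: Flip.
have nA : \sum_(i < n) K ^+ 2 * enorm (z i - z 0%N) ^+ 2 = K ^+ 2 * (n%:R * A).
  by rewrite -mulr_sumr /A mulVKf.
have e2 : enorm (z n - z 0%N + alpha *: Fz) ^+ 2 <= alpha ^+ 2 * (K ^+ 2 * A).
  have -> : z n - z 0%N + alpha *: Fz = (- alpha) *: (n%:R^-1 *: \sum_(i < n) dev i).
    rewrite zk// [_ - z 0%N]addrAC subrr add0r.
    rewrite (eq_bigl predT) => [|i]; last by rewrite ltn_ord.
    rewrite /dev [in RHS]big_split/= sumrN.
    rewrite [X in _ = _ *: (_ *: (_ - X))](_ : _ = n%:R *: Fz).
      by rewrite scalerBr !scalerA mulVf// scale1r scaleNr scalerBr opprB addrC scalerA.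
    by rewrite (sum_perm (fun i => F i (z 0%N))) FzE scalerA divff// scale1r.
  rewrite enormZ exprMn real_normK ?num_real// sqrrN ler_wpM2l ?sqr_ge0//.
  rewrite enorm_sqr; apply: le_trans (edot_mean_le _) _.
  rewrite -(ler_pM2l nRp) mulVKf// mulrCA -nA.
  exact: ler_sum.
have zk2 (k : 'I_n) : enorm (z k - z 0%N) ^+ 2 <= 3 * (alpha / n%:R) ^+ 2 *
    (k%:R * (K ^+ 2 * (n%:R * A)) + k%:R ^+ 2 * enorm Fz ^+ 2
      + enorm (partial_sum v s k) ^+ 2).
  have kn : (k <= n)%N := ltnW (ltn_ord k).
  rewrite zk// addrAC subrr add0r -scaleNr enormZ exprMn real_normK ?num_real// sqrrN.
  rewrite -[leRHS]mulrA [leRHS]mulrCA ler_wpM2l ?sqr_ge0// Fk// [leLHS]enorm_sqr.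
  apply: le_trans (edot_add3_le _ _ _) _; rewrite ler_wpM2l//.
  rewrite edotZl edotZr -!enorm_sqr mulrA -expr2 !lerD2r enorm_sqr.
  apply: le_trans (edot_sum_le [pred i : 'I_n | i < k]%N _) _.
  rewrite card_ord_lt// ler_wpM2l// -nA [leRHS](bigID [pred i : 'I_n | i < k]%N)/=.
  rewrite -[leLHS]addr0 lerD ?ler_sum// sumr_ge0// => i _.
  by rewrite mulr_ge0 ?sqr_ge0.
have nS : \sum_(k < n) enorm (partial_sum v s k) ^+ 2 = n%:R ^+ 3 * S.
  by rewrite /S mulVKf// expf_neq0.
(* The bound on [z k - z 0] involves the mean square [A] of these displacements
   itself; the coefficient of [A] is at most [3 / 16] by [Kalpha]. *)
have Abd : A <= 3 * alpha ^+ 2 * (K ^+ 2 * A / 2 + enorm Fz ^+ 2 / 3 + S).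
  have : n%:R * A <= 3 * (alpha / n%:R) ^+ 2 * (n%:R ^+ 2 / 2 * (K ^+ 2 * (n%:R * A))
      + n%:R ^+ 3 / 3 * enorm Fz ^+ 2 + n%:R ^+ 3 * S).
    have nAE : n%:R * A = \sum_(i < n) enorm (z i - z 0%N) ^+ 2 by rewrite /A mulVKf.
    rewrite [leLHS]nAE; apply: le_trans (ler_sum _ (fun k _ => zk2 k)) _.
    rewrite -mulr_sumr ler_wpM2l ?(mulr_ge0 _ (sqr_ge0 _))//.
    rewrite !big_split/= nS lerD2r -!mulr_suml lerD//.
      by rewrite ler_wpM2r ?sum_ord_le// mulr_ge0 ?sqr_ge0// mulr_ge0// ltW.
    by rewrite ler_wpM2r ?sqr_ge0 ?sum_ord_sqr_le.
  move=> h; rewrite -(ler_pM2l nRp); apply: le_trans h _.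
  rewrite le_eqVlt; apply/orP; left; apply/eqP.
  by field.
have KA := ler_wpM2r A0 Kalpha.
have S0 : 0 <= S.
  by rewrite mulr_ge0 ?invr_ge0 ?exprn_ge0// sumr_ge0// => k _; rewrite sqr_ge0.
have F0 := sqr_ge0 (enorm Fz).
have A1 : A <= 5 / 3 * alpha ^+ 2 * (enorm Fz ^+ 2 + 3 * S).
  have : 0 <= alpha ^+ 2 * (enorm Fz ^+ 2 + 3 * S).
    by rewrite mulr_ge0 ?sqr_ge0//; lra.
  lra.
apply: le_trans e2 _.
have := ler_wpM2l (mulr_ge0 (sqr_ge0 alpha) (sqr_ge0 K)) A1.
by rewrite -mulrA => /le_trans; apply; rewrite le_eqVlt; apply/orP; left; apply/eqP; ring.
Qed.

End Reshuffling.

(** * The normal map *)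

Section Favg.
Context {R : realType} {d n : nat}.
Local Notation V := 'rV[R]_d.
Variable f : 'I_n -> V -> R.
Hypothesis f_diff : forall i w, differentiable (f i) w.

Let favgE : favg f = n%:R^-1 \*: \sum_(i < n) f i.
Proof. by apply/funext => w; rewrite /favg/= fct_sumE. Qed.

Lemma favg_differentiable w : differentiable (favg f) w.
Proof.
by rewrite favgE; apply: differentiableZ; apply: differentiable_sum.
Qed.

Lemma grad_favg w : grad (favg f) w = n%:R^-1 *: \sum_(i < n) grad (f i) w.
Proof.
apply/rowP => j; rewrite !mxE summxE favgE.
have dv i : derivable (f i) w (delta_mx 0 j) by exact: diff_derivable.
rewrite deriveZ; last exact: derivable_sum.
by rewrite derive_sum//; congr (_ * _); apply: eq_bigr => i _; rewrite mxE.
Qed.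

Lemma favg_lipschitz (phi : V -> \bar R) (L : R) x y : (0 < n)%N ->
  lipschitz_gradients f phi L -> edom phi x -> edom phi y ->
  0 <= L -> enorm (grad (favg f) x - grad (favg f) y) <= L * enorm (x - y).
Proof.
move=> n0 flip xdom ydom L0; apply: enorm_le_sqr => //.
rewrite !grad_favg -scalerBr -sumrB; apply: le_trans (edot_mean_le _) _.
rewrite ler_pdivrMl ?ltr0n//.
have -> : n%:R * (L ^+ 2 * edot (x - y) (x - y)) = \sum_(i < n) L ^+ 2 * edot (x - y) (x - y).
  by rewrite sumr_const card_ord mulr_natl.
by apply: ler_sum => i _; apply: sqr_enorm_le; exact: flip.
Qed.

End Favg.

Section NormalMap.
Context {R : realType} {d n : nat}.
Local Notation V := 'rV[R]_d.
Variables (f : 'I_n -> V -> R) (phi : V -> \bar R) (L rho lambda : R).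
Hypothesis n_gt0 : (0 < n)%N.
Hypothesis f_diff : forall i w, differentiable (f i) w.
Hypothesis L_gt0 : 0 < L.
Hypothesis f_lip : lipschitz_gradients f phi L.
Hypothesis rho_gt0 : 0 < rho.
Hypothesis phi_wconv : weakly_convex rho phi.
Hypothesis phi_lsc : lower_semicontinuous phi.
Hypothesis phi_proper : proper_efun phi.
Hypothesis lambda_gt0 : 0 < lambda.
Hypothesis lambda_rho : lambda * rho < 1.
Implicit Types (z w : V).

Local Notation prx := (prox lambda phi).
Local Notation Fnor := (normal_map f phi lambda).

Let prx_dom z : edom phi (prx z).
Proof. exact: (prox_edom rho_gt0 phi_wconv phi_lsc phi_proper lambda_gt0). Qed.

(** As [w] is always [prox z] along the algorithm, an inner step is a step in [z] alone along this
    map. *)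
Definition component_map (i : 'I_n) z : V :=
  grad (f i) (prx z) + lambda^-1 *: (z - prx z).

Lemma normal_map_mean z : Fnor z = n%:R^-1 *: \sum_(i < n) component_map i z.
Proof.
rewrite /normal_map grad_favg// big_split/= sumr_const card_ord [in RHS]scalerDr.
congr (_ + _); rewrite -(scaler_nat n (lambda^-1 *: (z - prx z))) scalerA.
by rewrite mulVf ?scale1r// pnatr_eq0 -lt0n.
Qed.

(** Equals [lambda^-1 + (L + lambda^-1) / (1 - lambda * rho)]: the part of a component map that is
    linear in [z], plus the part that depends on [z] through [prox]. *)
Definition normal_lip : R := (L + 2 * lambda^-1 - rho) / (1 - lambda * rho).

Lemma component_map_lipschitz i z z' :
  enorm (component_map i z - component_map i z') <= normal_lip * enorm (z - z').
Proof.
have -> : component_map i z - component_map i z' =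
    (grad (f i) (prx z) - grad (f i) (prx z'))
    + (lambda^-1 *: (z - z') + - lambda^-1 *: (prx z - prx z')).
  rewrite /component_map.
  move: (prx z) (prx z') (grad _ (prx z)) (grad _ (prx z')) => w w' a b.
  by apply/rowP => j; rewrite !mxE; ring.
have lam0 : 0 < lambda^-1 by rewrite invr_gt0.
apply: le_trans (ler_enormD _ _) _.
apply: le_trans (lerD (f_lip i (prx_dom z) (prx_dom z')) (ler_enormD _ _)) _.
rewrite !enormZ normrN gtr0_norm//.
have pl := prox_lipschitz rho_gt0 phi_wconv phi_lsc phi_proper lambda_gt0 lambda_rho z' z.
have L1 : 0 <= L + lambda^-1 by rewrite addr_ge0// ltW.
have := ler_wpM2l L1 pl.
have -> : normal_lip = lambda^-1 + (L + lambda^-1) * (1 - lambda * rho)^-1.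
  by rewrite /normal_lip; field; rewrite !gt_eqF//= subr_gt0.
lra.
Qed.

Lemma psi_dom w : edom phi w -> psi f phi w = (favg f w + fine (phi w))%:E.
Proof. by move=> wdom; rewrite /psi (edom_fin phi_proper wdom). Qed.

Lemma psi_lsc : lower_semicontinuous (psi f phi).
Proof.
have -> : psi f phi = (fun w => phi w + (favg f w)%:E)%E.
  by apply/funext => w; rewrite /psi addeC.
apply: lsc_addr => // w; apply: differentiable_continuous.
exact: favg_differentiable.
Qed.

Lemma psi_infty w : (psi f phi w < +oo)%E -> edom phi w.
Proof.
rewrite /psi /edom/=.
by case: (phi w) => [r| |]; rewrite ?ltry ?ltNyr// addey// ltxx.
Qed.

Lemma normal_map_subdiff z : frechet_subdiff (psi f phi) (prx z) (Fnor z).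
Proof.
have wdom := prx_dom z; set w := prx z in wdom *.
split; first by rewrite psi_dom.
move=> e e0; rewrite psi_dom// -/w.
(* Within this radius the weak convexity term [rho / 2 * enorm (y - w) ^+ 2] is at most
   [e / 2 * enorm (y - w)]; the other half of [e] goes to the remainder of [favg f]. *)
have r0 : 0 < e / rho by rewrite divr_gt0.
have e20 : 0 < e / 2 by rewrite divr_gt0.
have n1 := differentiable_grad_near (favg_differentiable f_diff w) e20.
have n2 := nbhs_enorm w r0.
apply: (@filterS2 _ (nbhs w) _ _ _ _ _ n1 n2) => y h1.
rewrite ltr_pdivlMr// => h2.
have [ydom|] := pselect (edom phi y); last first.
  rewrite /edom/= /psi => /negP; rewrite -leNgt leye_eq => /eqP ->.
  by rewrite addey// leey.
rewrite (psi_dom ydom) -EFinD lee_fin /normal_map -/w edotDl edotZl.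
have h3 := prox_subgradient rho_gt0 phi_wconv phi_lsc phi_proper lambda_gt0 lambda_rho z ydom.
rewrite -/w in h3.
have h4 := ler_wpM2l (enorm_ge0 (y - w)) (ltW h2).
lra.
Qed.

End NormalMap.

(** * Step sizes *)

Section StepSizes.
Context {R : realType}.
Variables (L rho lambda alpha : R).
Hypothesis L_gt0 : 0 < L.
Hypothesis rho_gt0 : 0 < rho.
Hypothesis lambda_gt0 : 0 < lambda.
Hypothesis lambda_lt : lambda < (4 * rho)^-1.

Local Notation tau := (PRR_tau L rho lambda).
Local Notation C := (PRR_C L rho lambda).

Lemma lambda_rho_bounds : 0 < lambda * rho < 4^-1.
Proof.
rewrite mulr_gt0//=; move: lambda_lt; rewrite invfM.
by rewrite ltr_pdivlMr.
Qed.

Lemma PRR_tau_eq :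
  tau * (2 * (1 - 2 * (lambda * rho) + (lambda * L) ^+ 2)) = 1 - 4 * (lambda * rho).
Proof.
have /andP[x0 x1] := lambda_rho_bounds.
have y0 := sqr_ge0 (lambda * L).
by rewrite /PRR_tau -(mulrA 4) -(mulrA 2 lambda) -exprMn divfK// gt_eqF//; lra.
Qed.

(** With [x = lambda * rho] and [y = (lambda * L) ^+ 2], the equation for [tau] reads [2 * tau * (1
    + y) = 1 - 4 * x * (1 - tau)]. *)
Lemma PRR_tau_bounds : [/\ 0 < tau, tau <= 2^-1 &
  tau * (1 + (lambda * L) ^+ 2) <= 2^-1].
Proof.
have /andP[x0 x1] := lambda_rho_bounds.
have y0 : 0 < (lambda * L) ^+ 2 by rewrite exprn_gt0// mulr_gt0.
have tE := PRR_tau_eq.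
have t0 : 0 < tau.
  have D0 : 0 < 2 * (1 - 2 * (lambda * rho) + (lambda * L) ^+ 2) by lra.
  by rewrite -(pmulr_lgt0 _ D0) tE; lra.
have ty := mulr_gt0 t0 y0; have tx := mulr_gt0 t0 x0.
have tx1 : tau * (lambda * rho) <= tau * 4^-1 by rewrite ler_wpM2l ?ltW.
by split => //; nra.
Qed.

Lemma normal_lip_ge0 : 0 <= normal_lip L rho lambda.
Proof.
have /andP[x0 x1] := lambda_rho_bounds.
have rl : rho <= lambda^-1 by rewrite -[leRHS]mul1r ler_pdivlMr// mulrC; lra.
have l0 : 0 < lambda^-1 by rewrite invr_gt0.
by rewrite divr_ge0//; move: L_gt0; lra.
Qed.

(** [C] is four times the square of [normal_lip] with [3 * L] in place of [L]. The second bound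
    later converts a bound on [C * lambda * alpha] into one on [alpha / lambda]. *)
Lemma PRR_C_bounds : 4 * normal_lip L rho lambda ^+ 2 <= C /\ 16 <= C * lambda ^+ 2.
Proof.
have /andP[x0 x1] := lambda_rho_bounds; have := normal_lip_ge0.
rewrite /normal_lip /PRR_C; set q := 1 - lambda * rho.
have q0 : 0 < q by rewrite /q; lra.
have l0 : 0 < lambda^-1 by rewrite invr_gt0.
move=> k0; split.
  rewrite ler_pM2l//; apply: lerXn2r; rewrite ?nnegrE//.
    by apply: le_trans k0 _; rewrite ler_pM2r ?invr_gt0//; move: L_gt0; lra.
  by rewrite ler_pM2r ?invr_gt0//; move: L_gt0; lra.
set X := (3 * L + 2 * lambda^-1 - rho) / q.
have X2 : 2 <= X * lambda.
  rewrite /X mulrAC ler_pdivlMr//.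
  have -> : (3 * L + 2 * lambda^-1 - rho) * lambda = 3 * (L * lambda) + 2 - lambda * rho.
    by field; rewrite gt_eqF.
  by have := mulr_gt0 L_gt0 lambda_gt0; move: x0; rewrite /q; lra.
have : 0 <= (X * lambda - 2) * (X * lambda + 2) by rewrite mulr_ge0//; lra.
lra.
Qed.

Hypothesis alpha_gt0 : 0 < alpha.
Hypothesis alpha_le : alpha <= PRR_alpha_bar L rho lambda.

Lemma step_size_bounds : [/\ 2 * C * alpha ^+ 2 <= 1, 10 * L * alpha <= 1,
  4 * C * lambda * alpha <= tau & alpha / lambda <= 128^-1].
Proof.
have [t0 t1 _] := PRR_tau_bounds; have [_ C16] := PRR_C_bounds.
have C0 : 0 < C.
  by rewrite -(pmulr_lgt0 _ (exprn_gt0 2 lambda_gt0)); lra.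
have M0 : 0 < 10 * L by rewrite mulr_gt0.
have := alpha_le; rewrite /PRR_alpha_bar; set M := Num.max _ _.
have Mp : 0 < M by rewrite /M lt_max; apply/orP; right; rewrite lt_max M0.
rewrite -[_^-1]mul1r ler_pdivlMr// => aM.
have aMle v : v <= M -> alpha * v <= 1.
  by move=> vM; apply: le_trans aM; rewrite ler_pM2l.
have h1 : alpha * Num.sqrt (2 * C) <= 1 by apply: aMle; rewrite /M le_max lexx.
have h2 : alpha * (10 * L) <= 1 by apply: aMle; rewrite /M !le_max lexx orbT.
have h3 : alpha * (4 * C * lambda * tau^-1) <= 1.
  by apply: aMle; rewrite /M !le_max lexx !orbT.
have h3' : 4 * C * lambda * alpha <= tau.
  by rewrite mulrA ler_pdivrMr// mul1r in h3; rewrite mulrC.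
split => //.
- have s2 : Num.sqrt (2 * C) ^+ 2 = 2 * C by rewrite sqr_sqrtr// mulr_ge0 ?(ltW C0).
  have s0 : 0 <= alpha * Num.sqrt (2 * C) by rewrite mulr_ge0 ?sqrtr_ge0 ?ltW.
  have : 0 <= (1 - alpha * Num.sqrt (2 * C)) * (1 + alpha * Num.sqrt (2 * C)).
    by rewrite mulr_ge0//; lra.
  have -> : 2 * C * alpha ^+ 2 = (alpha * Num.sqrt (2 * C)) ^+ 2.
    by rewrite exprMn s2 mulrC.
  lra.
- lra.
(* By [C16] and [t1], [64 * (alpha / lambda) <= 4 * C * lambda * alpha <= tau <= 2^-1]. *)
rewrite ler_pdivrMr//.
have := ler_wpM2r (ltW alpha_gt0) C16.
have := ler_wpM2r (ltW lambda_gt0) (le_trans h3' t1).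
lra.
Qed.

End StepSizes.

(** * Descent over one epoch *)

Section MeritDescent.
Context {R : realType} {d n : nat}.
Local Notation V := 'rV[R]_d.
Variables (f : 'I_n -> V -> R) (phi : V -> \bar R) (L rho lambda alpha : R).
Hypothesis n_gt0 : (0 < n)%N.
Hypothesis f_diff : forall i w, differentiable (f i) w.
Hypothesis L_gt0 : 0 < L.
Hypothesis f_lip : lipschitz_gradients f phi L.
Hypothesis rho_gt0 : 0 < rho.
Hypothesis phi_wconv : weakly_convex rho phi.
Hypothesis phi_lsc : lower_semicontinuous phi.
Hypothesis phi_proper : proper_efun phi.
Hypothesis lambda_gt0 : 0 < lambda.
Hypothesis lambda_lt : lambda < (4 * rho)^-1.
Hypothesis alpha_gt0 : 0 < alpha.
Hypothesis alpha_le : alpha <= PRR_alpha_bar L rho lambda.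
Implicit Types (z w : V).

Local Notation prx := (prox lambda phi).
Local Notation Fnor := (normal_map f phi lambda).
Local Notation tau := (PRR_tau L rho lambda).
Local Notation C := (PRR_C L rho lambda).

(* Meaningful on [edom phi] only, since [fine +oo = 0]. *)
Definition psi_val w : R := favg f w + fine (phi w).

Definition merit_val z : R :=
  psi_val (prx z) + tau * lambda / 2 * enorm (Fnor z) ^+ 2.

Let lambda_rho : lambda * rho < 1.
Proof. by have := lambda_rho_bounds rho_gt0 lambda_gt0 lambda_lt; lra. Qed.

Let prx_dom z : edom phi (prx z).
Proof. exact: (prox_edom rho_gt0 phi_wconv phi_lsc phi_proper lambda_gt0). Qed.

Lemma merit_step_algebra (z z' w w' g g' F F' D : V) (p p' : R) :
  D = w' - w -> F = g + lambda^-1 *: (z - w) -> F' = g' + lambda^-1 *: (z' - w') ->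
  (1 - lambda * rho) * enorm D ^+ 2 <= edot (z' - z) D ->
  enorm (g' - g) <= L * enorm D ->
  p' <= p + edot (F + lambda^-1 *: (z' - z) - lambda^-1 *: D) D
    + (L + rho) / 2 * enorm D ^+ 2 ->
  alpha * (p' + tau * lambda / 2 * enorm F' ^+ 2)
    <= alpha * (p + tau * lambda / 2 * enorm F ^+ 2)
      - 3 / 8 * tau * alpha ^+ 2 * enorm F ^+ 2
      + 8 / 5 * enorm (z' - z + alpha *: F) ^+ 2.
Proof.
move=> DE FE F'E mono glip pstep.
have /andP[x0 x1] := lambda_rho_bounds rho_gt0 lambda_gt0 lambda_lt.
have [t0 t1 ty] := PRR_tau_bounds L_gt0 rho_gt0 lambda_gt0 lambda_lt.
have tE := PRR_tau_eq L rho_gt0 lambda_gt0 lambda_lt.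
have [_ aL _ a128] := step_size_bounds L_gt0 rho_gt0 lambda_gt0 lambda_lt alpha_gt0 alpha_le.
have lam0 : lambda != 0 by rewrite gt_eqF.
have alpha0 : alpha != 0 by rewrite gt_eqF.
have [a aE] : {a | a = alpha / lambda} by exists (alpha / lambda).
have [e eE] : {e | e = z' - z + alpha *: F} by exists (z' - z + alpha *: F).
have [G GE] : {G | G = lambda *: (g' - g)} by exists (lambda *: (g' - g)).
have a0 : 0 < a by rewrite aE divr_gt0.
have b1 : L * alpha <= 10^-1 by lra.
have {}mono : (1 - lambda * rho) * enorm D ^+ 2 <= edot (e - alpha *: F) D.
  by rewrite eE addrK.
have Gl : enorm G <= lambda * L * enorm D.
  by rewrite GE enormZ gtr0_norm// -mulrA ler_pM2l.
have aa : 0 < a <= 128^-1 by rewrite a0 aE.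
have xx : 0 <= lambda * rho <= 4^-1 by rewrite !ltW.
have tt : 0 < tau <= 2^-1 by rewrite t0.
(* An exact recursion for the normal map: [alpha *: (g' - g)] is [a *: G], and [z' - z] is
   [e - alpha *: F]. *)
have PE : alpha *: F' = (1 - a) *: (alpha *: F) + a *: (e + G - D).
  rewrite aE eE GE DE F'E FE.
  by apply/rowP => j; rewrite !mxE; field.
have key := merit_step_bound PE aa xx b1 tt ty tE mono Gl.
rewrite !enormZ_sqr in key.
have cross : alpha * edot (F + lambda^-1 *: (z' - z) - lambda^-1 *: D) D =
    (1 - a) * edot (alpha *: F) D + a * edot e D - a * enorm D ^+ 2.
  by rewrite eE aE enorm_sqr !(edotDl, edotZl, edotNl); field.
have m1 := ler_wpM2l (ltW alpha_gt0) pstep.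
rewrite !mulrDr cross in m1.
have merE : tau / (2 * a) * (alpha ^+ 2 * enorm F' ^+ 2 - alpha ^+ 2 * enorm F ^+ 2)
   = alpha * (tau * lambda / 2 * enorm F' ^+ 2 - tau * lambda / 2 * enorm F ^+ 2).
  by rewrite aE; field; rewrite lam0.
have arho : a * (lambda * rho) = alpha * rho by rewrite aE; field.
rewrite merE arho in key; rewrite -eE !mulrDr.
move: (edot _ _) (edot e D) (enorm D ^+ 2) (enorm F' ^+ 2) (enorm F ^+ 2)
  (enorm e ^+ 2) m1 key => p1 p2 p3 p4 p5 p6 m1 key.
lra.
Qed.

Lemma edom_segment w w' t : edom phi w -> edom phi w' -> 0 <= t <= 1 ->
  edom phi (w + t *: (w' - w)).
Proof.
move=> wdom w'dom t01; have := phi_wconv w' w t01; rewrite /=.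
have -> : t *: w' + (1 - t) *: w = w + t *: (w' - w).
  by apply/rowP => j; rewrite !mxE; ring.
rewrite (edom_fin phi_proper wdom) (edom_fin phi_proper w'dom) -!EFinD.
by rewrite /edom/=; case: (phi _) => [r| |]; rewrite ?ltry ?ltNyr.
Qed.

(** The smooth part is expanded at the old point, while the subgradient of [phi] is taken at the new
    one, since [phi] has to be bounded above there. The resulting vector is rewritten in terms of
    F(z). *)
Lemma psi_val_step z z' (D := prx z' - prx z) :
  psi_val (prx z') <= psi_val (prx z)
    + edot (Fnor z + lambda^-1 *: (z' - z) - lambda^-1 *: D) D
    + (L + rho) / 2 * enorm D ^+ 2.
Proof.
have fl x y : edom phi x -> edom phi y ->
    enorm (grad (favg f) x - grad (favg f) y) <= L * enorm (x - y).
  by move=> xdom ydom; apply: (favg_lipschitz f_diff n_gt0 f_lip) => //; exact: ltW.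
have h1 := @descent_lemma _ _ (favg f) (edom phi) L (prx z) (prx z') (ltW L_gt0)
  (favg_differentiable f_diff)
  (fun t => edom_segment (prx_dom z) (prx_dom z')) fl.
have h2 := prox_subgradient rho_gt0 phi_wconv phi_lsc phi_proper lambda_gt0
  lambda_rho z' (prx_dom z).
rewrite -/D in h1; rewrite (enormB (prx z)) -/D -(opprB (prx z') (prx z)) -/D edotNr in h2.
have -> : Fnor z + lambda^-1 *: (z' - z) - lambda^-1 *: D =
    grad (favg f) (prx z) + lambda^-1 *: (z' - prx z').
  rewrite /normal_map /D; move: (prx z) (prx z') (grad _ (prx z)) => w w' g.
  by apply/rowP => j; rewrite !mxE; ring.
by rewrite edotDl edotZl /psi_val; lra.
Qed.

Lemma merit_step z z' :
  alpha * merit_val z' <= alpha * merit_val z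
    - 3 / 8 * tau * alpha ^+ 2 * enorm (Fnor z) ^+ 2
    + 8 / 5 * enorm (z' - z + alpha *: Fnor z) ^+ 2.
Proof.
have mono := prox_monotone rho_gt0 phi_wconv phi_lsc phi_proper lambda_gt0 lambda_rho z z'.
have glip := favg_lipschitz f_diff n_gt0 f_lip (prx_dom z') (prx_dom z) (ltW L_gt0).
have pstep := psi_val_step z z'.
exact: (merit_step_algebra erefl erefl erefl mono glip pstep).
Qed.

End MeritDescent.

(** * One epoch as an inexact step, and the size of its order-dependent error *)

Section Epoch.
Context {R : realType} {d n : nat}.
Local Notation V := 'rV[R]_d.
Variables (f : 'I_n -> V -> R) (phi : V -> \bar R) (L rho lambda alpha : R).
Hypothesis n_gt0 : (0 < n)%N.
Hypothesis f_diff : forall i w, differentiable (f i) w.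
Hypothesis L_gt0 : 0 < L.
Hypothesis f_lip : lipschitz_gradients f phi L.
Hypothesis rho_gt0 : 0 < rho.
Hypothesis phi_wconv : weakly_convex rho phi.
Hypothesis phi_lsc : lower_semicontinuous phi.
Hypothesis phi_proper : proper_efun phi.
Hypothesis lambda_gt0 : 0 < lambda.
Hypothesis lambda_lt : lambda < (4 * rho)^-1.
Hypothesis alpha_gt0 : 0 < alpha.
Hypothesis alpha_le : alpha <= PRR_alpha_bar L rho lambda.
Implicit Types (z w : V) (s : 'S_n).

Local Notation prx := (prox lambda phi).
Local Notation Fnor := (normal_map f phi lambda).
Local Notation tau := (PRR_tau L rho lambda).
Local Notation C := (PRR_C L rho lambda).
Local Notation merit_val := (merit_val f phi L rho lambda).

Lemma epoch_iterates a s z : exists zs : nat -> V,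
  [/\ zs 0%N = z,
      forall i : 'I_n, zs i.+1 = zs i - a *: component_map f phi lambda (s i) (zs i) &
      epoch f phi lambda a s (z, prx z) = (zs n, prx (zs n))].
Proof.
pose st r := foldl (inner_step f phi lambda a s) (z, prx z) r.
have st2 r : st r = ((st r).1, prx (st r).1).
  by elim/last_ind: r => [//|r i _]; rewrite /st foldl_rcons.
exists (fun k => (st (take k (enum 'I_n))).1); split; first by rewrite take0.
  move=> i; rewrite (take_nth i) ?size_enum_ord// nth_ord_enum.
  by rewrite {1}/st foldl_rcons -/(st _) {1 2}st2.
by rewrite -st2 take_oversize// size_enum_ord.
Qed.

Definition grad_dev w (i : 'I_n) : V := grad (f i) w - grad (favg f) w.

(** The quantity [S] of [epoch_error]. The scale [n ^- 3] combines the square of the inner step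
    [alpha / n] with the mean over [n] inner steps. *)
Definition order_error s z : R :=
  n%:R ^- 3 * \sum_(k < n) enorm (partial_sum (grad_dev (prx z)) s k) ^+ 2.

Definition grad_variance w : R := n%:R^-1 * \sum_(i < n) enorm (grad_dev w i) ^+ 2.

Lemma merit_epoch s z z' : z' = (epoch f phi lambda (alpha / n%:R) s (z, prx z)).1 ->
  merit_val z' <= merit_val z - tau * alpha / 4 * enorm (Fnor z) ^+ 2
    + 2 * C * alpha ^+ 3 * order_error s z.
Proof.
have [zs [zs0 zsS ->]] := epoch_iterates (alpha / n%:R) s z => /= ->.
have [t0 t1 _] := PRR_tau_bounds L_gt0 rho_gt0 lambda_gt0 lambda_lt.
have [CK _] := PRR_C_bounds L_gt0 rho_gt0 lambda_gt0 lambda_lt.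
have [Ca _ Cat a128] := step_size_bounds L_gt0 rho_gt0 lambda_gt0 lambda_lt alpha_gt0 alpha_le.
have K0 := normal_lip_ge0 L_gt0 rho_gt0 lambda_gt0 lambda_lt.
have /andP[_ lr4] := lambda_rho_bounds rho_gt0 lambda_gt0 lambda_lt.
have lr1 : lambda * rho < 1 by apply: lt_trans lr4 _; rewrite invf_lt1// ltr1n.
have Klip := component_map_lipschitz L_gt0 f_lip rho_gt0 phi_wconv phi_lsc phi_proper
  lambda_gt0 lr1.
have Ka : 8 * normal_lip L rho lambda ^+ 2 * alpha ^+ 2 <= 1.
  have := ler_wpM2r (sqr_ge0 alpha) CK; lra.
have FzE : Fnor z = n%:R^-1 *: \sum_(i < n) component_map f phi lambda i (zs 0%N).
  by rewrite zs0 normal_map_mean.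
have := epoch_error n_gt0 K0 Klip zsS FzE Ka.
have devE : (fun i => component_map f phi lambda i (zs 0%N) - Fnor z) = grad_dev (prx z).
  apply/funext => i; rewrite zs0 /component_map /normal_map /grad_dev.
  by rewrite opprD addrACA subrr addr0.
rewrite devE -/(order_error s z) zs0.
have := merit_step n_gt0 f_diff L_gt0 f_lip rho_gt0 phi_wconv phi_lsc phi_proper
  lambda_gt0 lambda_lt alpha_gt0 alpha_le z (zs n).
move=> hM he; rewrite -(ler_pM2l alpha_gt0); move: hM he.
have S0 : 0 <= order_error s z.
  by rewrite mulr_ge0 ?invr_ge0 ?exprn_ge0// sumr_ge0// => k _; rewrite sqr_ge0.
have F0 := sqr_ge0 (enorm (Fnor z)).
move: (enorm (_ + _) ^+ 2) (merit_val (zs n)) (merit_val z) (order_error s z) S0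
  (enorm (Fnor z) ^+ 2) F0 => e2 M' M S S0 F2 F0 hM he.
(* The epoch error costs [2 / 3 * C * alpha ^+ 2] in the coefficient of [F2], far below the
   [tau / 8] that separates the [3 / 8] of [merit_step] from the claimed [1 / 4]. *)
have Caa : 512 * C * alpha ^+ 2 <= tau.
  have al0 : 0 <= alpha / lambda by rewrite divr_ge0// ltW.
  have := ler_wpM2r al0 Cat.
  have -> : 4 * C * lambda * alpha * (alpha / lambda) = 4 * C * alpha ^+ 2.
    by field; rewrite gt_eqF.
  have := ler_wpM2l (ltW t0) a128.
  lra.
have a2 := sqr_ge0 alpha.
have h0 := mulr_ge0 (ltW t0) (mulr_ge0 a2 F0).
have h1 := ler_wpM2r (mulr_ge0 a2 F0) Caa.
have h2 := ler_wpM2r (mulr_ge0 (mulr_ge0 a2 a2) (addr_ge0 F0 (mulr_ge0 (ler0n R 3) S0))) CK.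
lra.
Qed.

Lemma order_error_le s z : order_error s z <= grad_variance (prx z) / 2.
Proof.
have nR : 0 < n%:R :> R by rewrite ltr0n.
have v0 : 0 <= \sum_(i < n) enorm (grad_dev (prx z) i) ^+ 2.
  by rewrite sumr_ge0// => i _; rewrite sqr_ge0.
rewrite /order_error ler_pdivrMl ?exprn_gt0//.
apply: le_trans (ler_sum _ (fun (k : 'I_n) _ =>
  partial_sum_le (grad_dev (prx z)) s (ltnW (ltn_ord k)))) _.
rewrite -mulr_suml; apply: le_trans (ler_wpM2r v0 (sum_ord_le n)) _.
rewrite le_eqVlt; apply/orP; left; apply/eqP; rewrite /grad_variance; field.
by rewrite gt_eqF.
Qed.

Lemma sum_order_error_le z :
  \sum_(s : 'S_n) order_error s z <= n`!%:R * (grad_variance (prx z) / (2 * n%:R)).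
Proof.
have nR : 0 < n%:R :> R by rewrite ltr0n.
have dev0 : \sum_(i < n) grad_dev (prx z) i = 0.
  rewrite sumrB grad_favg// sumr_const card_ord -scaler_nat scalerA divff ?gt_eqF//.
  by rewrite scale1r subrr.
rewrite -mulr_sumr ler_pdivrMl ?exprn_gt0// exchange_big/=.
apply: le_trans (ler_sum _ (fun (k : 'I_n) _ =>
  sum_perm_partial_sum_le n_gt0 (ltnW (ltn_ord k)) dev0)) _.
rewrite -mulr_sumr -mulr_suml -/(grad_variance (prx z)).
have v0 : 0 <= grad_variance (prx z).
  by rewrite mulr_ge0 ?invr_ge0 ?(ltW nR)// sumr_ge0// => i _; rewrite sqr_ge0.
have := ler_wpM2l (ler0n R n`!) (ler_wpM2r v0 (sum_ord_le n)) => /le_trans; apply.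
by rewrite le_eqVlt; apply/orP; left; apply/eqP; field; rewrite gt_eqF.
Qed.

(** The deviations at [w] and [w'] differ by centred gradient differences, and centring only lowers
    a sum of squares. *)
Lemma grad_variance_le w w' : edom phi w -> edom phi w' ->
  grad_variance w <= 2 * grad_variance w' + 2 * L ^+ 2 * enorm (w - w') ^+ 2.
Proof.
move=> wdom w'dom; have nR : 0 < n%:R :> R by rewrite ltr0n.
pose x i := grad (f i) w - grad (f i) w'.
pose xbar := n%:R^-1 *: \sum_(i < n) x i.
have devE i : grad_dev w i = grad_dev w' i + (x i - xbar).
  rewrite /grad_dev /xbar /x !grad_favg// sumrB scalerBr.
  move: (grad (f i) w) (grad (f i) w') (n%:R^-1 *: _) (n%:R^-1 *: _) => a b a' b'.
  by apply/rowP => j; rewrite !mxE; ring.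
have var : \sum_(i < n) enorm (x i - xbar) ^+ 2 <= \sum_(i < n) enorm (x i) ^+ 2.
  have -> : \sum_(i < n) enorm (x i - xbar) ^+ 2 =
      \sum_(i < n) enorm (x i) ^+ 2 - n%:R * enorm xbar ^+ 2.
    under eq_bigr do rewrite enormB_sqr.
    rewrite !big_split/= sumr_const card_ord -[X in _ + X]mulr_natl.
    rewrite sumrN -mulr_sumr -edot_suml.
    have -> : \sum_(i < n) x i = n%:R *: xbar by rewrite scalerA divff ?gt_eqF ?scale1r.
    by rewrite edotZl -enorm_sqr; lra.
  by rewrite lerBlDr lerDl mulr_ge0 ?sqr_ge0 ?(ltW nR).
have xl : \sum_(i < n) enorm (x i) ^+ 2 <= n%:R * (L ^+ 2 * enorm (w - w') ^+ 2).
  rewrite mulr_natl -[X in _ *+ X]card_ord -sumr_const; apply: ler_sum => i _.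
  by rewrite !enorm_sqr; apply: sqr_enorm_le; exact: f_lip.
have s2 : \sum_(i < n) enorm (grad_dev w i) ^+ 2 <=
    2 * \sum_(i < n) enorm (grad_dev w' i) ^+ 2 + 2 * \sum_(i < n) enorm (x i - xbar) ^+ 2.
  rewrite !mulr_sumr -big_split; apply: ler_sum => i _ /=.
  rewrite devE enormD_sqr.
  by have := edot_young (grad_dev w' i) (x i - xbar) ltr01; rewrite invr1 -!enorm_sqr; lra.
rewrite /grad_variance ler_pdivrMl// mulrDr.
have -> : n%:R * (2 * (n%:R^-1 * \sum_(i < n) enorm (grad_dev w' i) ^+ 2)) =
    2 * \sum_(i < n) enorm (grad_dev w' i) ^+ 2 by field; rewrite gt_eqF.
apply: le_trans s2 _; rewrite lerD2l -mulrA mulrCA ler_pM2l//.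
exact: le_trans var xl.
Qed.

End Epoch.

(** * Averages over random permutations *)

Lemma sum_tupleS (R : nmodType) (A : finType) (T : nat) (F : seq A -> R) :
  \sum_(t : T.+1.-tuple A) F t = \sum_(a : A) \sum_(t : T.-tuple A) F (a :: t).
Proof.
rewrite pair_big/= (reindex (fun p : A * T.-tuple A => [tuple of p.1 :: p.2]))//=.
exists (fun t : T.+1.-tuple A => (thead t, [tuple of behead t])) => [[a t] _|t _] /=.
  by congr pair; apply: val_inj.
by rewrite [RHS]tuple_eta; apply: val_inj.
Qed.

Section UniformPermutations.
Context {R : realType} {disp : measure_display} {Omega : measurableType disp}.
Variables (P : probability Omega R) (n : nat) (p : nat -> Omega -> 'S_n).
Hypothesis p_iu : independent_uniform_permutations P p.

(** The cylinder event that the first permutations are those of [t], as a finite intersection in the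
    form that [mutually_independent] expects. *)
Let path_event (t : seq 'S_n) : set Omega :=
  \bigcap_(k in [set` [fset i in iota 0 (size t)]%fset]) (p k @^-1` [set nth 1%g t k]).

Let path_event_measurable t : measurable (path_event t).
Proof.
have [pm _ _] := p_iu.
by apply: fin_bigcap_measurable => // k _; exact: pm.
Qed.

Let path_event_prob t : P (path_event t) = (n`!%:R ^- size t)%:E.
Proof.
have [pm pu pind] := p_iu.
rewrite -[LHS]fineK ?fin_num_measure// pind; congr (_%:E).
under eq_bigr do rewrite pu.
rewrite big_const_seq count_predT card_fseq undup_id ?iota_uniq// size_iota.
by rewrite -[LHS]/(iter _ _ _) iter_mulr mulr1 exprVn.
Qed.

Let path_eventE t omega :
  path_event t omega <-> mkseq (fun k => p k omega) (size t) = t.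
Proof.
split=> [h|<- k /=].
  apply: (@eq_from_nth _ 1%g) => [|k]; rewrite size_mkseq// => kt.
  rewrite nth_mkseq//; apply: (h k) => /=.
  by rewrite in_fset mem_iota add0n.
by rewrite size_mkseq in_fset mem_iota add0n => kt; rewrite nth_mkseq.
Qed.

Lemma expectation_uniform_permutations (Phi : seq 'S_n -> R) (T : nat) :
  (forall t, 0 <= Phi t) ->
  (\int[P]_omega (Phi (mkseq (fun k => p k omega) T))%:E =
   (n`!%:R ^- T * \sum_(t : T.-tuple 'S_n) Phi t)%:E)%E.
Proof.
move=> Phi0.
have E omega : (Phi (mkseq (fun k => p k omega) T))%:E =
    (\sum_(t : T.-tuple 'S_n) (Phi t)%:E * (\1_(path_event t) omega)%:E)%E.
  have mT : size (mkseq (fun k => p k omega) T) == T by rewrite size_mkseq.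
  rewrite (bigD1 (Tuple mT))//= indicE mem_set ?mule1; last first.
    by apply/path_eventE; rewrite size_mkseq.
  rewrite big1 ?adde0// => t tn; rewrite indicE memNset ?mule0// => /path_eventE.
  by rewrite size_tuple => h; move: tn; rewrite -val_eqE/= h eqxx.
under eq_integral do rewrite E.
rewrite ge0_integral_sum//.
- rewrite mulr_sumr -sumEFin; apply: eq_bigr => t _.
  rewrite ge0_integralZl_EFin//.
  + rewrite integral_indic// setIT EFinM muleC; congr (_ * _)%E.
    by rewrite -[in RHS](size_tuple t); exact: path_event_prob.
  + by apply/measurable_EFinP; exact: measurable_indic.
- by move=> t; apply: measurable_funeM; apply/measurable_EFinP; exact: measurable_indic.
by move=> t omega _; rewrite mule_ge0// lee_fin.
Qed.

End UniformPermutations.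

(** * Convergence *)

Section AffineRecursion.
Context {R : realType}.

Lemma affine_bound_step (r D M M' N : R) (T : nat) : 0 <= r -> 0 < D ->
  M' - N <= r * (M - N) ->
  (r ^+ T * (M' - N) + N) / D <= (r ^+ T.+1 * (M - N) + N) / D.
Proof.
move=> r0 D0 h; rewrite ler_pM2r ?invr_gt0// lerD2r exprSr -mulrA.
by apply: ler_wpM2l => //; exact: exprn_ge0.
Qed.

(** A contraction of the mean of [M'] suffices, because the bound is affine in [M']. *)
Lemma sum_affine_bound_step (I : finType) (r D M N : R) (M' : I -> R) (T : nat) :
  (0 < #|I|)%N -> 0 <= r -> 0 < D ->
  #|I|%:R^-1 * (\sum_i M' i) - N <= r * (M - N) ->
  \sum_i (r ^+ T * (M' i - N) + N) / D <= #|I|%:R * ((r ^+ T.+1 * (M - N) + N) / D).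
Proof.
move=> I0 r0 D0 h; have I1 : 0 < #|I|%:R :> R by rewrite ltr0n.
apply: le_trans (ler_wpM2l (ltW I1) (affine_bound_step T r0 D0 h)).
rewrite -mulr_suml [leRHS]mulrA ler_pM2r ?invr_gt0//.
rewrite big_split/= sumr_const -(mulr_natl N) -mulr_sumr mulrDr lerD2r [leRHS]mulrCA.
apply: ler_wpM2l; first exact: exprn_ge0.
by rewrite big_split/= sumr_const -(mulr_natl (- N)) mulrBr mulVKf ?gt_eqF// mulrN.
Qed.

End AffineRecursion.

Section Convergence.
Context {R : realType} {d n : nat}.
Local Notation V := 'rV[R]_d.
Variables (f : 'I_n -> V -> R) (phi : V -> \bar R) (L rho lambda mu alpha : R).
Hypothesis n_gt0 : (0 < n)%N.
Hypothesis f_diff : forall i w, differentiable (f i) w.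
Hypothesis L_gt0 : 0 < L.
Hypothesis f_lip : lipschitz_gradients f phi L.
Hypothesis rho_gt0 : 0 < rho.
Hypothesis phi_wconv : weakly_convex rho phi.
Hypothesis phi_lsc : lower_semicontinuous phi.
Hypothesis phi_proper : proper_efun phi.
Hypothesis mu_gt0 : 0 < mu.
Hypothesis psi_PL : PL_condition f phi mu.
Hypothesis lambda_gt0 : 0 < lambda.
Hypothesis lambda_lt : lambda < (4 * rho)^-1.
Implicit Types (z w : V) (s : 'S_n).

Local Notation prx := (prox lambda phi).
Local Notation Fnor := (normal_map f phi lambda).
Local Notation tau := (PRR_tau L rho lambda).
Local Notation C := (PRR_C L rho lambda).
Local Notation nu := (PRR_nu L rho lambda mu).
Local Notation merit_val := (merit_val f phi L rho lambda).
Local Notation psi_val := (psi_val f phi).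

Hypothesis alpha_gt0 : 0 < alpha.
Hypothesis alpha_le : alpha <= Num.min (PRR_alpha_bar L rho lambda)
   (Num.min nu^-1 (mu * Num.sqrt tau / (2 * L * Num.sqrt (6 * C)))).

Variable ps : R.
Hypothesis psE : psi_inf f phi = ps%:E.

Let tau_gt0 : 0 < tau.
Proof. by case: (PRR_tau_bounds L_gt0 rho_gt0 lambda_gt0 lambda_lt). Qed.

Let C_gt0 : 0 < C.
Proof.
have [_ C16] := PRR_C_bounds L_gt0 rho_gt0 lambda_gt0 lambda_lt.
by rewrite -(pmulr_lgt0 _ (exprn_gt0 2 lambda_gt0)); lra.
Qed.

Let denom_gt0 : 0 < 1 + mu * tau * lambda.
Proof. exact: (addr_gt0 ltr01 (mulr_gt0 (mulr_gt0 mu_gt0 tau_gt0) lambda_gt0)). Qed.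

Lemma PRR_nu_gt0 : 0 < nu.
Proof.
exact: (divr_gt0 (mulr_gt0 mu_gt0 tau_gt0) (mulr_gt0 (ltr0n R 3) denom_gt0)).
Qed.

Let alpha_bar : alpha <= PRR_alpha_bar L rho lambda.
Proof. by move: alpha_le; rewrite le_min => /andP[]. Qed.

Lemma step_size_nu : nu * alpha <= 1.
Proof.
move: alpha_le; rewrite !le_min => /and3P[_ h _].
by rewrite mulrC -ler_pdivlMr ?PRR_nu_gt0// div1r.
Qed.

Lemma step_size_mu : 24 * L ^+ 2 * C * alpha ^+ 2 <= mu ^+ 2 * tau.
Proof.
move: alpha_le; rewrite !le_min => /and3P[_ _].
have c0 : 0 < 6 * C by exact: (mulr_gt0 (ltr0n R 6) C_gt0).
have s0 : 0 < Num.sqrt (6 * C) by rewrite sqrtr_gt0.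
have s2 : Num.sqrt (6 * C) ^+ 2 = 6 * C by rewrite sqr_sqrtr// ltW.
have t0 : 0 <= Num.sqrt tau by exact: sqrtr_ge0.
have t2 : Num.sqrt tau ^+ 2 = tau by rewrite sqr_sqrtr// (ltW tau_gt0).
have M0 : 0 < 2 * L * Num.sqrt (6 * C) by rewrite !mulr_gt0.
rewrite ler_pdivlMr// => h.
have : (alpha * (2 * L * Num.sqrt (6 * C))) ^+ 2 <= (mu * Num.sqrt tau) ^+ 2.
  apply: lerXn2r h; rewrite nnegrE.
    exact: (mulr_ge0 (ltW alpha_gt0) (ltW M0)).
  exact: (mulr_ge0 (ltW mu_gt0) t0).
rewrite !exprMn s2 t2; lra.
Qed.

Lemma psi_ge w : (ps%:E <= psi f phi w)%E.
Proof. by rewrite -psE; apply: ereal_inf_lbound; exists w. Qed.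

Let lambda_rho1 : lambda * rho < 1.
Proof. by have := lambda_rho_bounds rho_gt0 lambda_gt0 lambda_lt; lra. Qed.

Let prx_dom z : edom phi (prx z).
Proof. exact: (prox_edom rho_gt0 phi_wconv phi_lsc phi_proper lambda_gt0). Qed.

Lemma psi_val_ge w : edom phi w -> ps <= psi_val w.
Proof. by move=> wdom; have := psi_ge w; rewrite (psi_dom f phi_proper wdom). Qed.

Lemma PL_normal_map z : 2 * mu * (psi_val (prx z) - ps) <= enorm (Fnor z) ^+ 2.
Proof.
have := le_trans (psi_PL (prx_dom z)) (sqr_dist_set0_le
  (normal_map_subdiff f_diff rho_gt0 phi_wconv phi_lsc phi_proper lambda_gt0 lambda_rho1 z)).
by rewrite psE (psi_dom f phi_proper (prx_dom z)) -EFinB -EFinM lee_fin.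
Qed.

Variable sigma : R.
Hypothesis sigma_ge : forall w, solutions f phi w -> grad_variance f w <= sigma.

(** The variance at [w] is compared with that at a minimizer [y]. Quadratic growth locates [y] only
    up to an error [t], which is then sent to 0. *)
Lemma grad_variance_PL w : edom phi w ->
  grad_variance f w <= 2 * sigma + 4 * L ^+ 2 / mu * (psi_val w - ps).
Proof.
move=> wdom; set r := Num.sqrt (2 / mu * (psi_val w - ps)).
have h0 : 0 <= psi_val w - ps by rewrite subr_ge0 psi_val_ge.
have r2 : r ^+ 2 = 2 / mu * (psi_val w - ps).
  by rewrite sqr_sqrtr// mulr_ge0// divr_ge0// ltW.
have r0 : 0 <= r by exact: sqrtr_ge0.
(* The slope comes from [(r + t) ^+ 2 <= r ^+ 2 + t * (2 * r + 1)] for [t <= 1]. *)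
apply: (@ler_of_ler_mulr _ _ _ (2 * L ^+ 2 * (2 * r + 1))) => t /andP[t0 t1].
have PLx x : (psi f phi x < +oo)%E ->
    ((2 * mu)%:E * (psi f phi x - ps%:E) <= dist_set 0 (frechet_subdiff (psi f phi) x) ^+ 2)%E.
  by move=> xoo; rewrite -psE; apply: psi_PL; exact: (psi_infty xoo).
have [y yps wy] := PL_quadratic_growth (psi_lsc f_diff phi_lsc) psi_ge mu_gt0 PLx
  (psi_dom f phi_proper wdom) t0.
have ydom : edom phi y by apply: (@psi_infty _ _ _ f); rewrite yps ltry.
have yv : grad_variance f y <= sigma by apply: sigma_ge; rewrite /solutions/= psE.
have := grad_variance_le n_gt0 f_diff f_lip wdom ydom.
have wy2 : enorm (w - y) ^+ 2 <= (r + t) ^+ 2.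
  by apply: lerXn2r; rewrite ?nnegrE ?enorm_ge0// addr_ge0// ltW.
have t2 : t ^+ 2 <= t by rewrite expr2 ler_piMl// ltW.
have wy3 : enorm (w - y) ^+ 2 <= 2 / mu * (psi_val w - ps) + t * (2 * r + 1).
  by apply: le_trans wy2 _; rewrite -r2; lra.
have L2 : 0 <= 2 * L ^+ 2 by rewrite mulr_ge0// sqr_ge0.
have := ler_wpM2l L2 wy3.
move: yv; move: (enorm _ ^+ 2) (grad_variance f w) (grad_variance f y) (psi_val w - ps).
clear wy wy2 wy3 t2 r2 r0 h0 PLx yps ydom; clearbody r => q v v' h; lra.
Qed.

(** The decrease is spent as [1 / 4 = 1 / 12 + 1 / 6]: one third absorbs the part of the variance
    proportional to the gap of [psi], by [step_size_mu], and two thirds yield the contraction. *)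
Lemma merit_contraction z (X kappa : R) : 0 <= kappa <= 1 ->
  X <= merit_val z - tau * alpha / 4 * enorm (Fnor z) ^+ 2
    + C * alpha ^+ 3 * (kappa * grad_variance f (prx z)) ->
  X - ps <= (1 - nu * alpha) * (merit_val z - ps)
    + 2 * C * alpha ^+ 3 * kappa * sigma.
Proof.
move=> /andP[k0 k1] hX; have hPL := PL_normal_map z.
have gv := grad_variance_PL (prx_dom z).
have h0 : 0 <= psi_val (prx z) - ps by rewrite subr_ge0 psi_val_ge.
have mE : merit_val z = psi_val (prx z) + tau * lambda / 2 * enorm (Fnor z) ^+ 2 by [].
have hmu := step_size_mu; have nuE : nu * (3 * (1 + mu * tau * lambda)) = mu * tau.
  by rewrite /PRR_nu divfK// gt_eqF// mulr_gt0.
have nu0 := PRR_nu_gt0.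
rewrite mE in hX *; move: nuE nu0 hmu gv hPL h0 hX.
move: tau_gt0 C_gt0 (enorm _ ^+ 2) (grad_variance _ _) (psi_val _).
move: (PRR_nu _ _ _ _) (PRR_tau _ _ _) (PRR_C _ _ _) => nu' t C' t0 C0 F2 g p.
move: alpha_gt0 mu_gt0 lambda_gt0 L_gt0 => al0 m0 la0 L0 nuE nu0 hmu gv hPL h0 hX.
have a3 : 0 <= C' * alpha ^+ 3 by rewrite mulr_ge0 ?exprn_ge0// ltW.
have m1 := ler_wpM2l (mulr_ge0 a3 k0) gv.
have b1 : 4 * L ^+ 2 / mu * (p - ps) * (C' * alpha ^+ 3) <= alpha * mu * t * (p - ps) / 6.
  have q0 : 0 <= alpha * (p - ps) / (6 * mu) by rewrite divr_ge0 ?mulr_ge0// ltW.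
  have := ler_wpM2r q0 hmu.
  have -> : 24 * L ^+ 2 * C' * alpha ^+ 2 * (alpha * (p - ps) / (6 * mu)) =
    4 * L ^+ 2 / mu * (p - ps) * (C' * alpha ^+ 3) by field; rewrite gt_eqF.
  have -> // : mu ^+ 2 * t * (alpha * (p - ps) / (6 * mu)) = alpha * mu * t * (p - ps) / 6.
  by field; rewrite gt_eqF.
have b0 : 0 <= 4 * L ^+ 2 / mu * (p - ps) * (C' * alpha ^+ 3).
  by rewrite mulr_ge0// mulr_ge0// divr_ge0 ?mulr_ge0 ?sqr_ge0// ltW.
have b2 := ler_wpM2r b0 k1.
have b3 := ler_wpM2l (ltW (mulr_gt0 al0 t0)) hPL.
(* The PL inequality bounds the merit gap by [(1 + mu * t * lambda) / (2 * mu) * F2], and [nu] is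
   the rate for which this becomes exactly [t * F2 / 6]. *)
have b4 : nu' * (p - ps + t * lambda / 2 * F2) <= t * F2 / 6.
  have b5 := ler_wpM2l (ltW nu0) hPL.
  have b6 : nu' * (3 * (1 + mu * t * lambda)) * F2 = mu * t * F2 by rewrite nuE.
  by rewrite -(ler_pM2l m0); lra.
have b7 := ler_wpM2l (ltW al0) b4.
lra.
Qed.

Definition contraction_rate : R := 1 - nu * alpha.

(* The fixed point of the affine recursion for the merit gap; [kappa] is [1] for
   arbitrary permutations and [1 / n] for the average over permutations. *)
Definition noise_level (kappa : R) : R := 2 * C * alpha ^+ 3 * kappa * sigma / (nu * alpha).

Lemma affine_contraction z (X kappa : R) : 0 <= kappa <= 1 ->
  X <= merit_val z - tau * alpha / 4 * enorm (Fnor z) ^+ 2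
    + C * alpha ^+ 3 * (kappa * grad_variance f (prx z)) ->
  X - ps - noise_level kappa <= contraction_rate * (merit_val z - ps - noise_level kappa).
Proof.
move=> kk /(merit_contraction kk); rewrite /contraction_rate /noise_level.
set c := 2 * C * alpha ^+ 3 * kappa * sigma; set q := nu * alpha.
have q0 : q != 0 by rewrite gt_eqF// (mulr_gt0 PRR_nu_gt0 alpha_gt0).
have -> : (1 - q) * (merit_val z - ps - c / q) = (1 - q) * (merit_val z - ps) + c - c / q.
  have qc : q * (c / q) = c by rewrite mulrC divfK.
  by clearbody c q; lra.
by rewrite lerD2r.
Qed.

(** The squared normal map in the merit is itself at least [2 * mu] times the gap of [psi]; this
    produces the denominator in the final bounds. *)
Lemma psi_val_le_merit z :
  psi_val (prx z) - ps <= (merit_val z - ps) / (1 + mu * tau * lambda).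
Proof.
rewrite ler_pdivlMr ?denom_gt0//.
have := ler_wpM2l (ltW (mulr_gt0 tau_gt0 lambda_gt0)) (PL_normal_map z).
have mE : merit_val z = psi_val (prx z) + tau * lambda / 2 * enorm (Fnor z) ^+ 2 by [].
rewrite mE; lra.
Qed.

Definition shuffled_run (r : seq 'S_n) z : V * V :=
  foldl (fun zw s => epoch f phi lambda (alpha / n%:R) s zw) (z, prx z) r.

Definition epoch_map s z : V := (epoch f phi lambda (alpha / n%:R) s (z, prx z)).1.

Lemma epochE s z : epoch f phi lambda (alpha / n%:R) s (z, prx z) =
  (epoch_map s z, prx (epoch_map s z)).
Proof.
rewrite /epoch_map.
by have [zs [_ _ ->]] := epoch_iterates f phi lambda (alpha / n%:R) s z.
Qed.

Lemma shuffled_run_cons s r z : shuffled_run (s :: r) z = shuffled_run r (epoch_map s z).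
Proof. by rewrite /shuffled_run /= epochE. Qed.

Lemma norm_PRR_shuffled_run p z1 T :
  norm_PRR f phi lambda (fun=> alpha / n%:R) p z1 T = shuffled_run (mkseq p T) z1.
Proof.
elim: T => [//|T IH]; rewrite mkseqS /shuffled_run foldl_rcons -/(shuffled_run _ _) -IH.
by [].
Qed.

Lemma shuffled_run_pair r z : (shuffled_run r z).2 = prx (shuffled_run r z).1.
Proof. by elim: r z => [//|s r IH] z; rewrite shuffled_run_cons. Qed.

Lemma shuffled_run_dom r z : edom phi (shuffled_run r z).2.
Proof. by rewrite shuffled_run_pair. Qed.

Let epoch_map_le s z : merit_val (epoch_map s z) <= merit_val z
  - tau * alpha / 4 * enorm (Fnor z) ^+ 2 + 2 * C * alpha ^+ 3 * order_error f phi lambda s z.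
Proof.
exact: (merit_epoch n_gt0 f_diff L_gt0 f_lip rho_gt0 phi_wconv phi_lsc phi_proper
  lambda_gt0 lambda_lt alpha_gt0 alpha_bar erefl).
Qed.

Let rate_ge0 : 0 <= contraction_rate.
Proof. by rewrite subr_ge0 step_size_nu. Qed.

Let Ca_ge0 : 0 <= 2 * C * alpha ^+ 3.
Proof.
by rewrite (mulr_ge0 (mulr_ge0 _ (ltW C_gt0)))// exprn_ge0// ltW.
Qed.

Definition merit_bound (kappa : R) T z : R :=
  (contraction_rate ^+ T * (merit_val z - ps - noise_level kappa) + noise_level kappa)
    / (1 + mu * tau * lambda).

Lemma shuffled_run_le r z : psi_val (shuffled_run r z).2 - ps <= merit_bound 1 (size r) z.
Proof.
elim: r z => [|s r IH] z.
  by rewrite /merit_bound expr0 mul1r subrK; exact: psi_val_le_merit.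
rewrite shuffled_run_cons; apply: le_trans (IH _) _.
apply: (affine_bound_step _ rate_ge0 denom_gt0).
apply: affine_contraction; first by rewrite ler01 lexx.
apply: le_trans (epoch_map_le s z) _; rewrite lerD2l mul1r.
by have := ler_wpM2l Ca_ge0 (order_error_le f phi lambda n_gt0 s z); lra.
Qed.

(** Peeling off the first epoch keeps the remaining permutations independent of the point where they
    start, so the induction hypothesis applies at every [epoch_map s z] separately. *)
Lemma sum_shuffled_run_le T z :
  \sum_(t : T.-tuple 'S_n) (psi_val (shuffled_run t z).2 - ps)
    <= n`!%:R ^+ T * merit_bound n%:R^-1 T z.
Proof.
have n1 : 0 <= (n%:R^-1 : R) <= 1 by rewrite invr_ge0 ler0n invf_le1 ?ltr0n ?ler1n.
have nf : 0 < n`!%:R :> R by rewrite ltr0n fact_gt0.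
elim: T z => [|T IH] z.
  rewrite (eq_bigr (fun _ => psi_val (prx z) - ps)) => [|t _]; last by rewrite tuple0.
  rewrite sumr_const card_tuple expn0 mulr1n expr0 mul1r /merit_bound expr0 mul1r subrK.
  exact: psi_val_le_merit.
rewrite (sum_tupleS T (fun t => psi_val (shuffled_run t z).2 - ps)).
apply: (@le_trans _ _ (\sum_(s : 'S_n) n`!%:R ^+ T * merit_bound n%:R^-1 T (epoch_map s z))).
  apply: ler_sum => s _; apply: le_trans (IH _).
  by apply: ler_sum => t _; rewrite shuffled_run_cons.
rewrite -mulr_sumr exprSr -mulrA; apply: ler_wpM2l; first by rewrite exprn_ge0 ?(ltW nf).
rewrite -card_Sn; apply: (sum_affine_bound_step _ _ rate_ge0 denom_gt0).
  by rewrite card_Sn fact_gt0.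
rewrite card_Sn.
have -> : n`!%:R^-1 * \sum_s (merit_val (epoch_map s z) - ps) =
    n`!%:R^-1 * (\sum_s merit_val (epoch_map s z)) - ps.
  by rewrite big_split sumr_const card_Sn -(mulr_natl (- ps)) mulrDr mulKf ?gt_eqF.
apply: affine_contraction => //.
rewrite ler_pdivrMl//.
apply: le_trans (ler_sum _ (fun s _ => epoch_map_le s z)) _.
rewrite big_split/= sumr_const card_Sn [leRHS]mulrDr; apply: lerD.
  by rewrite mulr_natl.
rewrite -mulr_sumr.
apply: le_trans (ler_wpM2l Ca_ge0 (sum_order_error_le phi lambda n_gt0 f_diff z)) _.
by rewrite le_eqVlt; apply/orP; left; apply/eqP; field; rewrite pnatr_eq0 -lt0n.
Qed.

Lemma merit_bound_le kappa T z : 0 <= kappa -> 0 <= sigma ->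
  merit_bound kappa T z <=
    expR (- (T%:R * nu * alpha)) * ((merit_val z - ps) / (1 + mu * tau * lambda))
    + 6 * C * alpha ^+ 2 * kappa / (mu * tau) * sigma.
Proof.
move=> k0 s0; have nu0 := PRR_nu_gt0.
have nn : 0 <= noise_level kappa.
  rewrite /noise_level (mulr_ge0 (mulr_ge0 (mulr_ge0 Ca_ge0 k0) s0))//.
  by rewrite invr_ge0 ltW// mulr_gt0.
have m0 : 0 <= merit_val z - ps.
  rewrite subr_ge0; apply: le_trans (psi_val_ge (prx_dom z)) _.
  have -> : merit_val z = psi_val (prx z) + tau * lambda / 2 * enorm (Fnor z) ^+ 2 by [].
  by rewrite lerDl (mulr_ge0 (divr_ge0 (ltW (mulr_gt0 tau_gt0 lambda_gt0)) _))// sqr_ge0.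
have re : contraction_rate ^+ T <= expR (- (T%:R * nu * alpha)).
  rewrite -mulrA -mulrN expRM_natl; apply: lerXn2r.
  - by rewrite nnegrE rate_ge0.
  - by rewrite nnegrE expR_ge0.
  exact: expR_ge1Dx.
rewrite /merit_bound mulrDl mulrA; apply: lerD; last first.
  (* The factor [3 * (1 + mu * tau * lambda)] in [nu] cancels the denominator and turns the 2 of
     [noise_level] into 6. *)
  rewrite le_eqVlt; apply/orP; left; apply/eqP; rewrite /noise_level /PRR_nu; field.
  by rewrite !gt_eqF//= ?mulr_gt0.
rewrite ler_pM2r ?invr_gt0 ?denom_gt0//.
apply: (@le_trans _ _ (contraction_rate ^+ T * (merit_val z - ps))).
  by rewrite ler_wpM2l ?exprn_ge0 ?rate_ge0// lerBlDr lerDl.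
by rewrite ler_wpM2r.
Qed.

End Convergence.

(** * Transfer of the real-valued bounds to extended reals and to the expectation *)

Theorem theorem14 (R : realType) (d n : nat)
    (f : 'I_n -> 'rV[R]_d -> R) (phi : 'rV[R]_d -> \bar R)
    (L rho mu lambda alpha : R) (z1 : 'rV[R]_d)
    (n_gt0 : (0 < n)%N)
    (f_diff : forall (i : 'I_n) (w : 'rV[R]_d), differentiable (f i) w)
    (L_gt0 : 0 < L)
    (f_lip : lipschitz_gradients f phi L)
    (rho_gt0 : 0 < rho)
    (phi_wconv : weakly_convex rho phi)
    (phi_lsc : lower_semicontinuous phi)
    (phi_proper : proper_efun phi)
    (sol_neq0 : solutions f phi !=set0)
    (mu_gt0 : 0 < mu)
    (psi_PL : PL_condition f phi mu)
    (lambda_gt0 : 0 < lambda)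
    (lambda_lt : lambda < (4 * rho)^-1) :
  let C := PRR_C L rho lambda in
  let tau := PRR_tau L rho lambda in
  let nu := PRR_nu L rho lambda mu in
  let psi_star := psi_inf f phi in
  let step := fun _ : nat => alpha / n%:R in
  forall (alpha_gt0 : 0 < alpha)
    (alpha_le : alpha <= Num.min (PRR_alpha_bar L rho lambda)
       (Num.min nu^-1 (mu * Num.sqrt tau / (2 * L * Num.sqrt (6 * C))))),
  (forall (p : nat -> 'S_n) (T : nat), (1 <= T)%N ->
     (psi f phi (norm_PRR f phi lambda step p z1 T).2 - psi_star
      <= (expR (- (T%:R * nu * alpha)))%:E
           * ((merit f phi lambda tau z1 - psi_star)
                / (1 + mu * tau * lambda)%:E)
         + (6 * C * alpha ^+ 2 / (mu * tau))%:E * sigma_star_sq f phi)%E)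
  /\
  (forall (disp : measure_display) (Omega : measurableType disp)
     (P : probability Omega R) (p : nat -> Omega -> 'S_n),
     independent_uniform_permutations P p ->
     forall T : nat, (1 <= T)%N ->
     (\int[P]_omega
        (psi f phi (norm_PRR f phi lambda step (fun k => p k omega) z1 T).2
           - psi_star)
      <= (expR (- (T%:R * nu * alpha)))%:E
           * ((merit f phi lambda tau z1 - psi_star)
                / (1 + mu * tau * lambda)%:E)
         + (6 * C * alpha ^+ 2 / (n%:R * mu * tau))%:E
             * sigma_star_sq f phi)%E).
Proof.
move=> C tau nu psi_star step alpha_gt0 alpha_le.
have lr : lambda * rho < 1.
  have /andP[_ lr4] := lambda_rho_bounds rho_gt0 lambda_gt0 lambda_lt.
  by apply: lt_trans lr4 _; rewrite invf_lt1// ltr1n.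
have pdom z := prox_edom rho_gt0 phi_wconv phi_lsc phi_proper lambda_gt0 lr z.
(* Attainment excludes the value [-oo], and a point of the domain of [phi] excludes [+oo]. *)
have [ps psE] : exists ps, psi_star = ps%:E.
  have [w0 w0sol] := sol_neq0; have [_ [x0 x0dom]] := phi_proper.
  have : (psi_star <= psi f phi x0)%E by apply: ereal_inf_lbound; exists x0.
  rewrite (psi_dom f phi_proper x0dom).
  have : psi f phi w0 = psi_star by [].
  rewrite /psi; case: (phi w0) (proj1 phi_proper w0) => [r| |] // _ <- //=.
  by move=> _; exists (favg f w0 + r).
have tau_gt0 : 0 < tau by case: (PRR_tau_bounds L_gt0 rho_gt0 lambda_gt0 lambda_lt).
have denom_gt0 : 0 < 1 + mu * tau * lambda.
  exact: (addr_gt0 ltr01 (mulr_gt0 (mulr_gt0 mu_gt0 tau_gt0) lambda_gt0)).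
have C_gt0 : 0 < C.
  have [_ C16] := PRR_C_bounds L_gt0 rho_gt0 lambda_gt0 lambda_lt.
  by rewrite -(pmulr_lgt0 _ (exprn_gt0 2 lambda_gt0)); apply: lt_le_trans C16.
have mE : ((merit f phi lambda tau z1 - psi_star) / (1 + mu * tau * lambda)%:E =
    ((merit_val f phi L rho lambda z1 - ps) / (1 + mu * tau * lambda))%:E)%E.
  by rewrite /merit (psi_dom f phi_proper (pdom z1)) psE inver gt_eqF.
have wE w : edom phi w -> (psi f phi w - psi_star = (psi_val f phi w - ps)%:E)%E.
  by move=> wdom; rewrite (psi_dom f phi_proper wdom) psE.
have run_dom := shuffled_run_dom f alpha rho_gt0 phi_wconv phi_lsc phi_proper
  lambda_gt0 lambda_lt.
have sig0 : (0 <= sigma_star_sq f phi)%E.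
  have [w wsol] := sol_neq0; apply: ereal_sup_ge; exists (grad_variance f w)%:E.
    by exists w.
  by rewrite lee_fin mulr_ge0 ?invr_ge0// sumr_ge0// => i _; rewrite sqr_ge0.
have mt_gt0 : 0 < mu * tau by exact: (mulr_gt0 mu_gt0 tau_gt0).
have c_gt0 : 0 < 6 * C * alpha ^+ 2 by rewrite (mulr_gt0 (mulr_gt0 _ C_gt0))// exprn_gt0.
have n_gt0R : 0 < n%:R :> R by rewrite ltr0n.
(* If the supremum is infinite, both right-hand sides are [+oo] because its coefficients are
   positive. *)
case sE : (sigma_star_sq f phi) sig0 => [sigma| |] // sig0; last first.
  have oo (c : R) : 0 < c -> forall (x : \bar R) (y : R), (x <= y%:E + c%:E * +oo)%E.
    by move=> c0 x y; rewrite gt0_muley ?lte_fin// addey// leey.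
  split=> [p T T1|disp Omega P p _ T T1].
    by rewrite mE -EFinM; apply: oo; rewrite divr_gt0.
  rewrite mE -EFinM; apply: oo; rewrite divr_gt0//.
  by rewrite -mulrA mulr_gt0.
have sigma_ge w : solutions f phi w -> grad_variance f w <= sigma.
  by move=> wsol; rewrite -lee_fin -sE; apply: ereal_sup_ubound; exists w.
have bnd kappa T k0 := @merit_bound_le _ _ _ _ _ _ _ _ _ _ L_gt0 rho_gt0 phi_wconv phi_lsc
  phi_proper mu_gt0 lambda_gt0 lambda_lt alpha_gt0 alpha_le ps psE sigma kappa T z1 k0 sig0.
split=> [p T T1|disp Omega P p p_iu T T1].
  rewrite norm_PRR_shuffled_run wE// mE -!EFinM -EFinD lee_fin.
  have := shuffled_run_le n_gt0 f_diff L_gt0 f_lip rho_gt0 phi_wconv phi_lsc phi_proper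
    mu_gt0 psi_PL lambda_gt0 lambda_lt alpha_gt0 alpha_le psE sigma_ge (mkseq p T) z1.
  rewrite size_mkseq => /le_trans; apply; apply: le_trans (bnd 1 T ler01) _.
  by rewrite mulr1.
have ps_ge t : 0 <= psi_val f phi (shuffled_run f phi lambda alpha t z1).2 - ps.
  by rewrite subr_ge0; apply: (psi_val_ge _ psE).
under eq_integral do rewrite norm_PRR_shuffled_run wE//.
rewrite (expectation_uniform_permutations p_iu
  (Phi := fun t => psi_val f phi (shuffled_run f phi lambda alpha t z1).2 - ps))//.
rewrite mE -!EFinM -EFinD lee_fin.
have nf : 0 < n`!%:R ^+ T :> R by rewrite exprn_gt0// ltr0n fact_gt0.
rewrite ler_pdivrMl//.
apply: le_trans (sum_shuffled_run_le n_gt0 f_diff L_gt0 f_lip rho_gt0 phi_wconv phi_lsc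
  phi_proper mu_gt0 psi_PL lambda_gt0 lambda_lt alpha_gt0 alpha_le psE sigma_ge T z1) _.
rewrite ler_pM2l//; apply: le_trans (bnd n%:R^-1 T _) _; first by rewrite invr_ge0.
rewrite lerD2l le_eqVlt; apply/orP; left; apply/eqP; congr (_ * _).
by rewrite -!mulrA -invfM mulrA.
Qed.
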